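(* Let $E/F$ be an unramified cubic field extension of non-Archimedean local fields, $x\in\mathcal O_E^\times$ with $\mathcal O_E=\mathfrak o[x]$, $n\ge0$ an integer, and $R=\mathfrak o[\pi^nx]$. For integers $s,f\ge 0$ with $0\le s-f\le\min(n,f)$ and $c\in\mathfrak o$ put $$\mathcal O^1_{s,f,c}=\mathfrak o\langle1,\ \pi^{s-f}(x+c\pi^{f-\min(n,f)}x^2),\ \pi^fx^2\rangle,\qquad \mathcal O^2_{s,f,c}=\mathfrak o\langle1,\ \pi^fx,\ \pi^{s-f}(c\pi x+x^2)\rangle,$$ where for $\mathcal O^2_{s,f,c}$ it is also required that $f>s-f$. Then: $\mathcal O^1_{s,f,c}$ is an overorder of $R$ if and only if $\frac12s\le f\le\frac23s$ and $s\le f+n$; $\mathcal O^2_{s,f,c}$ is an overorder of $R$ if and only if $\frac12s<f\le\frac23s$ and $f\le n$. Moreover, for those $\mathcal O^i_{s,f,c}$ that are overorders of $R$: (1) $S(\mathcal O^i_{s,f,c})=s$ and $f(\mathcal O^i_{s,f,c})=f$ for $i=1,2$; (2) $\mathcal O^1_{s,f,c}=\mathcal O^1_{s',f',c'}$ if and only if $(s,f)=(s',f')$ and $c-c'\in(\pi^{\min(n,f)-(s-f)})$; and $\mathcal O^2_{s,f,c}=\mathcal O^2_{s',f',c'}$ if and only if $(s,f)=(s',f')$ and $c-c'\in(\pi^{2f-s-1})$; (3) $\mathcal O^1_{s,f,c}\ne\mathcal O^2_{s',f',c'}$ for $s'<2f'$; (4) $\mathcal O^i_{s,f,c}$ is Gorenstein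 if and only if $\frac32f=s$, for $i=1,2$. These give an explicit classification of all overorders of $R$ (every overorder of $R$ is one of these).
   Context: $F$ has any characteristic, ring of integers $\mathfrak o$, uniformizer $\pi$. $\mathfrak o\langle u_1,u_2,u_3\rangle$ denotes the $\mathfrak o$-submodule of $E$ generated by $u_1,u_2,u_3$. An order of $E$ is a subring $\mathcal O\subset E$ containing $\mathfrak o$, finitely generated as an $\mathfrak o$-module, with $F\mathcal O=E$; an overorder of $R$ is an order containing $R$. $S(\mathcal O)$ is the $\mathfrak o$-length of $\mathcal O_E/\mathcal O$; $f(\mathcal O)\ge0$ is defined by $\{a\in\mathcal O_E:a\mathcal O_E\subset\mathcal O\}=\pi^{f(\mathcal O)}\mathcal O_E$. A fractional $\mathcal O$-ideal is a nonzero finitely generated $\mathcal O$-submodule $I\subset E$; it is invertible if $IJ=\mathcal O$ for some fractional ideal $J$. $\mathcal O$ is Gorenstein if every fractional $\mathcal O$-ideal $I$ with $\{y\in E:yI\subset I\}=\mathcal O$ is invertible. *)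

(* Defs.v *)
From HB Require Import structures.
From mathcomp Require Import all_boot all_order all_algebra all_field.
From mathcomp Require Import boolp classical_sets.

Set Implicit Arguments.
Unset Strict Implicit.
Unset Printing Implicit Defensive.

Import Order.TTheory GRing.Theory Num.Theory.
Local Open Scope ring_scope.
Local Open Scope classical_set_scope.

(** * Non-Archimedean local fields

    A valuation is a function [v : K -> int] whose value at [0] is irrelevant;
    [val_ge v m] is the fractional ideal of elements of valuation at least
    [m], where [0] has valuation [+oo]. *)

Section LocalField.
Variables (K : fieldType) (v : K -> int).

Definition val_ge (m : int) : set K := [set a | a = 0 \/ m <= v a].

Definition ring_of_integers : set K := val_ge 0.

Record normalized_discrete_valuation : Prop := {
  valuationM : forall a b, a != 0 -> b != 0 -> v (a * b) = v a + v b;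
  valuationD : forall a b, a != 0 -> b != 0 -> a + b != 0 ->
    Num.min (v a) (v b) <= v (a + b);
  valuation_surj : forall m : int, exists2 a, a != 0 & v a = m
}.

Definition val_cauchy (u : nat -> K) : Prop :=
  forall m : int, exists N : nat,
    forall i j : nat, (N <= i)%N -> (N <= j)%N -> val_ge m (u i - u j).

Definition val_cvg (u : nat -> K) (l : K) : Prop :=
  forall m : int, exists N : nat,
    forall i : nat, (N <= i)%N -> val_ge m (u i - l).

Definition val_complete : Prop :=
  forall u, val_cauchy u -> exists l, val_cvg u l.

(* Finitely many elements meet every class of the ring of integers modulo
   its maximal ideal. *)
Definition finite_residue_field : Prop :=
  exists r : seq K, forall a, ring_of_integers a ->
    exists b, [/\ b \in r, ring_of_integers b & val_ge 1 (a - b)].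

Record local_field : Prop := {
  local_field_valuation : normalized_discrete_valuation;
  local_field_complete : val_complete;
  local_field_residue : finite_residue_field
}.

Definition uniformizer (pi : K) : Prop := pi != 0 /\ v pi = 1.

(* The ideal of the ring of integers generated by [b]. *)
Definition principal_ideal (b : K) : set K :=
  [set a | exists2 d, ring_of_integers d & a = b * d].

Definition integer_unit (a : K) : Prop :=
  ring_of_integers a /\ exists2 b, ring_of_integers b & a * b = 1.

End LocalField.

Definition has_ramification_index (F : fieldType) (E : fieldExtType F)
    (v : F -> int) (w : E -> int) (e : nat) : Prop :=
  (0 < e)%N /\ forall a : F, a != 0 -> w a%:A = v a *+ e.

(* Residue fields are finite, hence perfect, so that separability of the
   residue extension need not be required. *)
Definition unramified (F : fieldType) (E : fieldExtType F)
    (v : F -> int) (w : E -> int) : Prop :=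
  has_ramification_index v w 1.

(** * Modules and orders inside [E]

    Subrings and submodules are subsets of [E]; the scalars range over a
    subset [A] of [E], which is a subring wherever this matters. *)

Section Modules.
Variable E : fieldType.
Implicit Types (A I J M N : set E).

Definition is_subring A : Prop :=
  [/\ A 1, forall a b, A a -> A b -> A (a - b)
    & forall a b, A a -> A b -> A (a * b)].

Definition is_submodule A M : Prop :=
  [/\ M 0, forall y z, M y -> M z -> M (y + z)
    & forall a y, A a -> M y -> M (a * y)].

Definition span A (us : seq E) : set E :=
  [set z | exists2 b : 'I_(size us) -> E, (forall i, A (b i))
             & z = \sum_(i < size us) b i * us`_i].

Definition finitely_generated A M : Prop := exists us : seq E, M = span A us.

(* Finite sums of products; this is [I J] for ideals and [F O] for the
   extension of scalars of [O]. *)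
Definition product_set I J : set E :=
  [set z | exists k (a b : 'I_k -> E),
     [/\ forall i, I (a i), forall i, J (b i) & z = \sum_(i < k) a i * b i]].

(* [C 0], ..., [C k] is a strictly increasing chain of [A]-submodules between
   [M] and [N], i.e. a chain of length [k] of submodules of [N / M]. *)
Definition submodule_chain A M N (C : nat -> set E) (k : nat) : Prop :=
  [/\ forall i, (i <= k)%N -> is_submodule A (C i),
      forall i, (i < k)%N -> C i `<` C i.+1,
      M `<=` C 0%N & C k `<=` N].

(* The [A]-length of [N / M], for [A]-submodules [M] and [N] with [M `<=` N],
   is finite and equal to [l]. *)
Definition quotient_length A N M (l : nat) : Prop :=
  (exists C, submodule_chain A M N C l) /\
  (forall C k, submodule_chain A M N C k -> (k <= l)%N).

Definition fractional_ideal A I : Prop :=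
  [/\ is_submodule A I, finitely_generated A I & exists2 z, I z & z != 0].

Definition invertible_ideal A I : Prop :=
  exists2 J, fractional_ideal A J & product_set I J = A.

Definition multiplier_ring I : set E :=
  [set y | forall z, I z -> I (y * z)].

Definition gorenstein A : Prop :=
  forall I, fractional_ideal A I -> multiplier_ring I = A ->
    invertible_ideal A I.

End Modules.

Section Orders.
Variables (F : fieldType) (E : fieldExtType F) (v : F -> int) (w : E -> int).

Definition base_field : set E := [set a%:A | a in [set: F]].

Definition base_integers : set E := [set a%:A | a in ring_of_integers v].

Definition adjoin_integers (y : E) : set E :=
  [set z | exists2 p : {poly F}, (forall i, ring_of_integers v p`_i)
             & z = horner_alg y p].

Definition is_order (O : set E) : Prop :=
  [/\ is_subring O, base_integers `<=` O, finitely_generated base_integers O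
    & product_set base_field O = [set: E]].

Definition is_overorder (R O : set E) : Prop := is_order O /\ R `<=` O.

(* [S(O) = s] *)
Definition has_colength (O : set E) (s : nat) : Prop :=
  quotient_length base_integers (ring_of_integers w) O s.

Definition conductor (O : set E) : set E :=
  [set a | ring_of_integers w a /\
           forall b, ring_of_integers w b -> O (a * b)].

(* [f(O) = f] *)
Definition has_conductor_exponent (pi : F) (O : set E) (f : nat) : Prop :=
  conductor O = [set pi ^+ f *: b | b in ring_of_integers w].

Variables (pi : F) (x : E) (n : nat).

Definition admissible1 (s f : nat) (c : F) : Prop :=
  [/\ (f <= s)%N, (s - f <= minn n f)%N & ring_of_integers v c].

Definition order1 (s f : nat) (c : F) : set E :=
  span base_integers
    [:: 1; pi ^+ (s - f) *: (x + (c * pi ^+ (f - minn n f)) *: x ^+ 2);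
        pi ^+ f *: x ^+ 2].

Definition admissible2 (s f : nat) (c : F) : Prop :=
  admissible1 s f c /\ (s - f < f)%N.

Definition order2 (s f : nat) (c : F) : set E :=
  span base_integers
    [:: 1; pi ^+ f *: x; pi ^+ (s - f) *: ((c * pi) *: x + x ^+ 2)].

End Orders.

(* Main.v *)
Require Import Defs.
From mathcomp Require Import all_boot all_order all_algebra all_field.
From mathcomp Require Import boolp classical_sets.
From mathcomp Require Import ring zify.

Set Implicit Arguments.
Unset Strict Implicit.
Unset Printing Implicit Defensive.

Import Order.TTheory GRing.Theory Num.Theory.
Local Open Scope ring_scope.
Local Open Scope classical_set_scope.

(* An [o]-module [M] with [1] in [M], [M] inside [O_E] and [pi^N O_E] inside [M]
   has the form [o + pi^e o y + pi^f O_E] with [e <= f] and [y = a x + b x^2],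
   where [a] or [b] is a unit. Since the residue field of [E] is a cubic extension
   of that of [F], such a [y] satisfies [O_E = o[y]]. Hence [M] is a ring iff
   [pi^(2 e) y^2] lies in [M], i.e. iff [f <= 2 e], its colength is [e + f], its
   conductor is [pi^f O_E], and [y] is determined up to units and modulo
   [o + pi^(f - e) O_E]. The two families correspond to [a = 1] and to [b = 1],
   [pi | a]; the condition that [pi^n x] lies in [M] cuts out the overorders.
   An ideal with multiplier ring [M], scaled to contain [1] as an element of
   least valuation, is again of this form, which decides the Gorenstein
   property: it holds iff [f = 2 e]. *)

(** Residue fields stay implicit: reduction modulo [pi] is the relation of valuation at least 1, and
    that [O_E / pi O_E] is a domain is [val_ge_prime]. Completeness serves to show that [1, x, x^2]
    are independent modulo [pi]; from then on questions about lattices are read off coordinates in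
    [1, y, y^2]. Two vectors [a x + b x^2] and [a' x + b' x^2] can give the same lattice only if
    [a b' - a' b] lies in [(pi^(f - e))]. This one determinant yields the congruences between
    parameters in both families and the disjointness of the families. *)

Section Valuation.
Variables (K : fieldType) (v : K -> int).
Hypothesis v_val : normalized_discrete_valuation v.

(** * Calculus with valuations *)

Lemma valuation1 : v 1 = 0.
Proof.
have := valuationM v_val (oner_neq0 K) (oner_neq0 K).
by rewrite mulr1; move: (v 1); lia.
Qed.

Lemma valuationN a : a != 0 -> v (- a) = v a.
Proof.
move=> a0; have N0 : (-1 : K) != 0 by rewrite oppr_eq0 oner_eq0.
have := valuationM v_val N0 N0; rewrite mulrNN mulr1 valuation1 => v1.
by rewrite -mulN1r (valuationM v_val N0 a0); lia.
Qed.

Lemma valuationV a : a != 0 -> v a^-1 = - v a.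
Proof.
move=> a0; have a'0 : a^-1 != 0 by rewrite invr_eq0.
have := valuationM v_val a0 a'0; rewrite divff // valuation1; lia.
Qed.

Lemma valuationX a k : a != 0 -> v (a ^+ k) = k%:Z * v a.
Proof.
move=> a0; elim: k => [|k IHk]; first by rewrite expr0 valuation1; lia.
by rewrite exprS (valuationM v_val a0) ?expf_neq0 // IHk; lia.
Qed.

Lemma val_ge_valuation m a : a != 0 -> val_ge v m a -> m <= v a.
Proof. by move=> a0 [a_eq0|//]; rewrite a_eq0 eqxx in a0. Qed.

Lemma val_geW m k a : val_ge v k a -> m <= k -> val_ge v m a.
Proof. by case=> [->|ka] mk; [left | right; lia]. Qed.

Lemma val_geN m a : val_ge v m a -> val_ge v m (- a).
Proof.
have [->|a0] := eqVneq a 0; first by rewrite oppr0.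
by case=> [->|ma]; [rewrite oppr0; left | right; rewrite valuationN].
Qed.

Lemma val_geD m a b : val_ge v m a -> val_ge v m b -> val_ge v m (a + b).
Proof.
have [->|a0] := eqVneq a 0; first by rewrite add0r.
have [->|b0] := eqVneq b 0; first by rewrite addr0.
have [->|ab0] := eqVneq (a + b) 0; first by left.
move=> /(val_ge_valuation a0) ma /(val_ge_valuation b0) mb; right.
by apply: le_trans (valuationD v_val a0 b0 ab0); rewrite le_min ma mb.
Qed.

Lemma val_geM m k a b :
  val_ge v m a -> val_ge v k b -> val_ge v (m + k) (a * b).
Proof.
have [->|a0] := eqVneq a 0; first by rewrite mul0r; left.
have [->|b0] := eqVneq b 0; first by rewrite mulr0; left.
move=> /(val_ge_valuation a0) ma /(val_ge_valuation b0) mb; right.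
by rewrite valuationM //; lia.
Qed.

Lemma val_geM_le l m k a b :
  val_ge v m a -> val_ge v k b -> l <= m + k -> val_ge v l (a * b).
Proof. by move=> ma kb; apply: val_geW (val_geM ma kb). Qed.

Lemma val_ge_1 : val_ge v 0 1.
Proof. by right; rewrite valuation1. Qed.

Lemma val_geX m a : val_ge v m a -> val_ge v (m + m) (a ^+ 2).
Proof. by move=> ma; rewrite expr2; apply: val_geM. Qed.

Lemma val_ge_exp a k : val_ge v 0 a -> val_ge v 0 (a ^+ k).
Proof.
move=> a0; elim: k => [|k IHk]; first by rewrite expr0; apply: val_ge_1.
by rewrite exprS; apply: val_geM_le a0 IHk _.
Qed.

(** Only an upper bound on [v a] is asked, so that it applies alike to powers of [pi], with [k] the
    exponent, and to units, with [k = 0]. *)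
Lemma val_ge_cancel m k a b :
  a != 0 -> v a <= k -> val_ge v (m + k) (a * b) -> val_ge v m b.
Proof.
move=> a0 va; have [->|b0] := eqVneq b 0; first by left.
move/(val_ge_valuation (mulf_neq0 a0 b0)); rewrite valuationM // => ?.
by right; lia.
Qed.

Lemma val_ge_prime a b : val_ge v 0 a -> val_ge v 0 b ->
  val_ge v 1 (a * b) -> val_ge v 1 a \/ val_ge v 1 b.
Proof.
have [->|a0] := eqVneq a 0; first by left; left.
have [->|b0] := eqVneq b 0; first by right; left.
move=> /(val_ge_valuation a0) ma /(val_ge_valuation b0) mb.
move=> /(val_ge_valuation (mulf_neq0 a0 b0)); rewrite valuationM // => ab.
have [?|?] : 1 <= v a \/ 1 <= v b by lia.
  by left; right.
by right; right.
Qed.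

Lemma val_ge_ex a : exists k : nat, val_ge v (- k%:Z) a.
Proof. by exists `|v a|%N; right; lia. Qed.

Lemma val_ge_eq0 a : (forall k : nat, val_ge v k%:Z a) -> a = 0.
Proof.
move=> ka; apply/eqP; apply: contrapT => /negP a0.
by have := val_ge_valuation a0 (ka `|v a|.+1); lia.
Qed.

(** Units are encoded as [~ val_ge v 1 a], next to [val_ge v 0 a] where integrality matters. *)
Lemma unit_valuation a : a != 0 -> ~ val_ge v 1 a -> v a <= 0.
Proof. by move=> a0 a1; apply: contrapT => va; apply: a1; right; lia. Qed.

Lemma not_val_ge_1_1 : ~ val_ge v 1 1.
Proof.
by move=> /(val_ge_valuation (oner_neq0 K)); rewrite valuation1.
Qed.

Lemma not_val_ge_neq0 m a : ~ val_ge v m a -> a != 0.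
Proof. by move=> ma; apply/eqP => a0; apply: ma; left. Qed.

Lemma val_ge_unitV a : ~ val_ge v 1 a -> val_ge v 0 a^-1.
Proof.
move=> a1; have a0 := not_val_ge_neq0 a1.
by right; rewrite valuationV //; have := unit_valuation a0 a1; lia.
Qed.

Lemma val_ge_unit_cancel m a b :
  ~ val_ge v 1 a -> val_ge v m (a * b) -> val_ge v m b.
Proof.
move=> a1 ab; have a0 := not_val_ge_neq0 a1.
by apply: (val_ge_cancel a0 (unit_valuation a0 a1)); rewrite addr0.
Qed.

Lemma uniformizer_exp pi k : uniformizer v pi -> v (pi ^+ k) = k%:Z.
Proof. by case=> pi0 vpi; rewrite valuationX // vpi mulr1. Qed.

Lemma val_ge_uniformizer pi k : uniformizer v pi -> val_ge v k%:Z (pi ^+ k).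
Proof. by move=> pi_unif; right; rewrite uniformizer_exp. Qed.

Lemma principal_idealE pi m a : uniformizer v pi ->
  principal_ideal v (pi ^+ m) a <-> val_ge v m%:Z a.
Proof.
move=> pi_unif; have pim0 : pi ^+ m != 0 by rewrite expf_neq0 //; case: pi_unif.
split=> [[d d0 ->]|am].
  by apply: val_geM_le (val_ge_uniformizer m pi_unif) d0 _; rewrite addr0.
exists (a / pi ^+ m); last by rewrite mulrC divfK.
apply: (@val_ge_cancel 0 m (pi ^+ m)) => //.
  by rewrite uniformizer_exp.
by rewrite mulrC divfK // add0r.
Qed.

Lemma val_ge_sum k m (a : 'I_k -> K) :
  (forall i, val_ge v m (a i)) -> val_ge v m (\sum_i a i).
Proof. by move=> ma; apply: big_ind => //; [left | exact: val_geD]. Qed.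

(** This sums the [pi]-adic expansions of coefficients. Later partial sums differ from the [k]-th
    one by terms of valuation at least [k], and the limit inherits this rate by comparison with a
    far partial sum. *)
Lemma val_complete_series (u : nat -> K) :
  val_complete v -> (forall i : nat, val_ge v i%:Z (u i)) ->
  exists l, forall k : nat, val_ge v k%:Z (l - \sum_(i < k) u i).
Proof.
move=> v_complete u_ge; pose S k := \sum_(i < k) u i.
have SB k N : val_ge v N%:Z (S (k + N)%N - S N).
  elim: k => [|k IHk]; first by rewrite subrr; left.
  rewrite addSn /S big_ord_recr /= -/(S _) addrAC.
  by apply: val_geD IHk _; apply: val_geW (u_ge _) _; lia.
have [m|l l_lim] := v_complete S.
  have [N mN] : exists N : nat, m <= N%:Z by exists `|m|%N; lia.
  exists N => i k /subnK <- /subnK <-.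
  rewrite -(subrKA (S N)) -[S N - _]opprB; apply: val_geW mN.
  by apply: val_geD (SB _ _) _; apply: val_geN (SB _ _).
exists l => k; have [N lN] := l_lim k%:Z.
have := lN (N + k)%N (leq_addr _ _); move/val_geN; rewrite opprB => lS.
rewrite -(subrKA (S (N + k)%N)); apply: val_geD lS _; exact: SB.
Qed.

End Valuation.

(** * Integral generators of an unramified cubic extension *)

Section UnramifiedExtension.
Variables (F : fieldType) (E : fieldExtType F) (v : F -> int) (w : E -> int).
Variable pi : F.
Hypotheses (v_val : normalized_discrete_valuation v)
  (w_val : normalized_discrete_valuation w)
  (w_alg : forall a : F, a != 0 -> w a%:A = v a)
  (pi_unif : uniformizer v pi).

Local Notation "a %:E" := (in_alg E a) (at level 2, format "a %:E").

Lemma val_ge_alg m a : val_ge w m a%:E <-> val_ge v m a.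
Proof.
rewrite in_algE; have [->|a0] := eqVneq a 0; first by rewrite scale0r; split=> _; left.
have aE0 : a%:A != 0 :> E by rewrite scaler_eq0 negb_or a0 oner_neq0.
split=> [/(val_ge_valuation aE0)|/(val_ge_valuation a0)];
  by [rewrite w_alg //; right | right; rewrite w_alg].
Qed.

Lemma uniformizer_alg : uniformizer w pi%:E.
Proof.
case: pi_unif => pi0 vpi; rewrite in_algE; split; rewrite ?w_alg //.
by rewrite scaler_eq0 negb_or pi0 oner_neq0.
Qed.

Lemma val_ge_pi k : val_ge v k%:Z (pi ^+ k).
Proof. exact: val_ge_uniformizer. Qed.

(* [val] bounds the valuation of a polynomial expression from the bounds on its
   atoms found in the context. *)
Ltac val_leaf := multimatch goal with
  | H : val_ge ?u _ ?a |- val_ge ?u _ ?a => exact H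
  | |- val_ge _ _ (pi ^+ _) => exact: val_ge_pi
  end.

Ltac val_sub := val_leaf + lazymatch goal with
  | |- val_ge _ _ (- _) => refine (val_geN _ _); [assumption | val_sub]
  | |- val_ge _ _ (_ * _) => refine (val_geM _ _ _); [assumption | val_sub | val_sub]
  | |- val_ge _ _ (_ ^+ 2) => refine (val_geX _ _); [assumption | val_sub]
  | |- val_ge _ _ (in_alg _ _) => refine (proj2 (val_ge_alg _ _) _); val_sub
  | |- val_ge _ _ 1 => refine (val_ge_1 _); assumption
  | |- val_ge _ 0 0 => left; reflexivity
  | |- val_ge _ _ (_ + _) => refine (val_geD _ _ _);
      [assumption | val_sub | refine (val_geW _ _); [val_sub | lia]]
  end.

Ltac val := (refine (val_geW _ _); [val_leaf | lia]) || lazymatch goal with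
  | |- val_ge _ _ (_ + _) => refine (val_geD _ _ _); [assumption | val | val]
  | |- val_ge _ _ (- _) => refine (val_geN _ _); [assumption | val]
  | |- val_ge _ _ 0 => left; reflexivity
  | |- _ => refine (val_geW _ _); [val_sub | lia]
  end.

Definition lin (y : E) (c0 c1 c2 : F) : E := c0%:E + c1%:E * y + c2%:E * y ^+ 2.

(* Equivalently, [1, y, y^2] is an [o]-basis of [O_E]. *)
Record integral_generator (y : E) : Prop := {
  ig_integral : val_ge w 0 y;
  ig_span : forall z, exists c0 c1 c2, z = lin y c0 c1 c2;
  ig_coord : forall m c0 c1 c2, val_ge w m (lin y c0 c1 c2) ->
    [/\ val_ge v m c0, val_ge v m c1 & val_ge v m c2]
}.

Lemma val_ge_lin m y c0 c1 c2 : val_ge w 0 y ->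
  val_ge v m c0 -> val_ge v m c1 -> val_ge v m c2 -> val_ge w m (lin y c0 c1 c2).
Proof. by move=> y0 c0m c1m c2m; rewrite /lin; val. Qed.

(** Independence modulo [pi] improves a denominator bound [pi^(k+1)] to [pi^k], and iterating
    removes the denominator; scaling handles every [m]. A linear relation then has coordinates of
    arbitrarily large valuation, so [1, y, y^2] is free, and a basis since the degree is 3. *)
Lemma integral_generatorP y : \dim {:E}%VS = 3%N -> val_ge w 0 y ->
  (forall c0 c1 c2, val_ge v 0 c0 -> val_ge v 0 c1 -> val_ge v 0 c2 ->
     val_ge w 1 (lin y c0 c1 c2) ->
     [/\ val_ge v 1 c0, val_ge v 1 c1 & val_ge v 1 c2]) ->
  integral_generator y.
Proof.
move=> dimE y0 y_res.
have lin_scale t c0 c1 c2 : lin y (t * c0) (t * c1) (t * c2) = t%:E * lin y c0 c1 c2.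
  by rewrite /lin !rmorphM; ring.
have coord0 k c0 c1 c2 : val_ge v (- k%:Z) c0 -> val_ge v (- k%:Z) c1 ->
    val_ge v (- k%:Z) c2 -> val_ge w 0 (lin y c0 c1 c2) ->
    [/\ val_ge v 0 c0, val_ge v 0 c1 & val_ge v 0 c2].
  elim: k c0 c1 c2 => [|k IHk] c0 c1 c2 c0k c1k c2k lin0.
    by [].
  have [t t0 vt] := valuation_surj v_val k.+1%:Z.
  have tk : val_ge v k.+1%:Z t by right; rewrite vt.
  have [c0' c1' c2'] : [/\ val_ge v 1 (t * c0), val_ge v 1 (t * c1) & val_ge v 1 (t * c2)].
    by apply: y_res; [val | val | val | rewrite lin_scale; val].
  have vtk : v t <= k.+1%:Z by rewrite vt.
  apply: IHk lin0; apply: (val_ge_cancel v_val t0 vtk); apply: val_geW; try eassumption; lia.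
have lin_ge m c0 c1 c2 : val_ge w m (lin y c0 c1 c2) ->
    [/\ val_ge v m c0, val_ge v m c1 & val_ge v m c2].
  move=> linm; have [t t0 vt] := valuation_surj v_val (- m).
  have tm : val_ge v (- m) t by right; rewrite vt.
  have vtm : v t <= - m by rewrite vt.
  have lin0 : val_ge w 0 (lin y (t * c0) (t * c1) (t * c2)).
    by rewrite lin_scale; val.
  have [k0 c0k] := val_ge_ex v (t * c0).
  have [k1 c1k] := val_ge_ex v (t * c1).
  have [k2 c2k] := val_ge_ex v (t * c2).
  have [] := coord0 (k0 + k1 + k2)%N (t * c0) (t * c1) (t * c2) => //; try by val.
  move=> ? ? ?; split; apply: (val_ge_cancel v_val t0 vtm); rewrite subrr //.
split=> // z.
pose X := [tuple 1; y; y ^+ 2].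
have linE (c : 'I_3 -> F) : \sum_(i < 3) c i *: X`_i = lin y (c 0) (c 1) (c 2%:R).
  rewrite !big_ord_recl big_ord0 /= /lin !in_algE !mulr_algl addr0 addrA.
  by congr (c _ *: _ + c _ *: _ + c _ *: _); apply: val_inj.
have X_free : free X.
  apply/freeP => c; rewrite linE => lin0.
  have c_ge m : [/\ val_ge v m (c 0), val_ge v m (c 1) & val_ge v m (c 2%:R)].
    by apply: lin_ge; rewrite lin0; left.
  have c0 : c 0 = 0 by apply: (@val_ge_eq0 _ v) => k; have [] := c_ge k%:Z.
  have c1 : c 1 = 0 by apply: (@val_ge_eq0 _ v) => k; have [] := c_ge k%:Z.
  have c2 : c 2%:R = 0 by apply: (@val_ge_eq0 _ v) => k; have [] := c_ge k%:Z.
  move=> i; have [->|[->|->]] //: i = 0 \/ i = 1 \/ i = 2%:R.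
  by case: i => [[|[|[|i]]] lti] //; [left|right; left|right; right]; apply: val_inj.
have X_basis : basis_of {:E} X by rewrite basisEfree X_free subvf dimE.
exists (coord X 0 z), (coord X 1 z), (coord X 2%:R z).
by rewrite -(linE (fun i => coord X i z)) -(coord_basis X_basis (memvf z)).
Qed.

(* If [1, x, x^2] were dependent modulo [pi], then [O_E = o + o x + pi O_E],
   hence [O_E = o + o x] by completeness, contradicting the degree. *)
Lemma generator_residually_independent x c0 c1 c2 :
  val_complete v -> \dim {:E}%VS = 3%N -> ring_of_integers w = adjoin_integers v x ->
  val_ge w 0 x -> val_ge v 0 c0 -> val_ge v 0 c1 -> val_ge v 0 c2 ->
  val_ge w 1 (lin x c0 c1 c2) -> [/\ val_ge v 1 c0, val_ge v 1 c1 & val_ge v 1 c2].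
Proof.
move=> v_complete dimE x_gen x0 c00 c10 c20 lin1.
pose M := [set z : E | exists a b, [/\ val_ge v 0 a, val_ge v 0 b &
  val_ge w 1 (z - a%:E - b%:E * x)]].
(* A relation modulo [pi] with [c1] or [c2] a unit puts [x^2] in [M]: divide by [c2], or, when [pi]
   divides [c2], divide by [c1] and multiply by [x]. *)
suff notM : ~ M (x ^+ 2).
  have c2_1 : val_ge v 1 c2.
    apply: contrapT => c2u; have c2V := val_ge_unitV v_val c2u.
    have c2n0 := not_val_ge_neq0 c2u.
    apply: notM; exists (- (c0 / c2)), (- (c1 / c2)); split; [val | val |].
    suff -> : x ^+ 2 - (- (c0 / c2))%:E - (- (c1 / c2))%:E * x = (c2^-1)%:E * lin x c0 c1 c2 by val.
    rewrite /lin; have e : (c2^-1)%:E * c2%:E = 1 by rewrite -rmorphM mulVf // rmorph1.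
    by rewrite !rmorphN !rmorphM -[x ^+ 2 in LHS]mul1r -[in LHS]e; ring.
  have c1_1 : val_ge v 1 c1.
    apply: contrapT => c1u; have c1V := val_ge_unitV v_val c1u.
    have c1n0 := not_val_ge_neq0 c1u.
    apply: notM; exists 0, (- (c0 / c1)); split; [by left | val |].
    suff -> : x ^+ 2 - 0%:E - (- (c0 / c1))%:E * x =
      ((c1^-1)%:E * x) * (lin x c0 c1 c2 - c2%:E * x ^+ 2) by val.
    rewrite /lin; have e : (c1^-1)%:E * c1%:E = 1 by rewrite -rmorphM mulVf // rmorph1.
    by rewrite rmorph0 !rmorphN !rmorphM -[x ^+ 2 in LHS]mul1r -[in LHS]e; ring.
  split=> //; apply/val_ge_alg.
  suff -> : c0%:E = lin x c0 c1 c2 - c1%:E * x - c2%:E * x ^+ 2 by val.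
  by rewrite /lin; ring.
move=> [a2 [b2 [a20 b20 x2M]]].
(* Horner induction: once [x^2] lies in [M], multiplication by [x] preserves [M]. *)
have M_all z : val_ge w 0 z -> M z.
  rewrite -[val_ge w 0]/(ring_of_integers w) x_gen => -[p p0 ->] {z}.
  elim/poly_ind: p p0 => [|p c IHp] pc0.
    rewrite rmorph0; exists 0, 0; split; try by left.
    by rewrite rmorph0 mul0r !subr0; left.
  have c_0 : val_ge v 0 c by have := pc0 0%N; rewrite coefD coefMX coefC add0r.
  have [i|a [b [a0 b0 M_p]]] := IHp.
    by have := pc0 i.+1; rewrite coefD coefMX coefC addr0.
  exists (c + b * a2), (a + b * b2); split; [val | val |].
  rewrite rmorphD rmorphM /= horner_algX horner_algC.
  set q := horner_alg x p in M_p *.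
  suff -> : q * x + c%:A - (c + b * a2)%:E - (a + b * b2)%:E * x =
     (q - a%:E - b%:E * x) * x + b%:E * (x ^+ 2 - a2%:E - b2%:E * x) by val.
  by rewrite -in_algE !rmorphD !rmorphM; ring.
(* Digits [a], [b] and a remainder for each integral [z]; the default outside [O_E] is the zero
   triple. *)
have /choice[f f_spec] z : exists t : F * F * E, val_ge w 0 z ->
    [/\ val_ge v 0 t.1.1, val_ge v 0 t.1.2, val_ge w 0 t.2 &
      z = t.1.1%:E + t.1.2%:E * x + pi%:E * t.2].
  have [|nz0] := pselect (val_ge w 0 z); last by exists (0, 0, 0) => /nz0.
  move=> /M_all[a [b [a0 b0]]]; have [piE0 wpi] := uniformizer_alg.
  exists (a, b, (z - a%:E - b%:E * x) / pi%:E) => _ /=; split=> //.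
    apply: (@val_ge_cancel _ _ w_val 0 1 pi%:E); rewrite ?wpi //.
    by rewrite mulrC divfK.
  by rewrite [pi%:E * _]mulrC divfK //; ring.
(* Iterating the remainder expands both coefficients in powers of [pi]; completeness sums the two
   series, and the error has valuation at least [k] for every [k]. *)
have O_span z : val_ge w 0 z -> exists a b, z = a%:E + b%:E * x.
  move=> z0; pose zs i := iter i (fun z => (f z).2) z.
  have zs0 i : val_ge w 0 (zs i) by elim: i => //= i /f_spec[].
  have zE k : z = (\sum_(i < k) pi ^+ i * (f (zs i)).1.1)%:E +
      (\sum_(i < k) pi ^+ i * (f (zs i)).1.2)%:E * x + (pi ^+ k)%:E * zs k.
    elim: k => [|k IHk].
      by rewrite !big_ord0 !rmorph0 expr0 rmorph1 mul0r !add0r mul1r.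
    have sumS (u : nat -> F) : \sum_(i < k.+1) u i = \sum_(i < k) u i + u k.
      by rewrite big_ord_recr.
    rewrite (sumS (fun i => pi ^+ i * (f (zs i)).1.1)).
    rewrite (sumS (fun i => pi ^+ i * (f (zs i)).1.2)).
    rewrite {1}IHk; have [_ _ _] := f_spec _ (zs0 k).
    rewrite -[(f (zs k)).2]/(zs k.+1) => {1}->.
    by rewrite !rmorphD !rmorphM exprS rmorphM; ring.
  have [k|a a_lim] := @val_complete_series _ _ v_val (fun i => pi ^+ i * (f (zs i)).1.1) v_complete.
    by have [? _ _ _] := f_spec _ (zs0 k); val.
  have [k|b b_lim] := @val_complete_series _ _ v_val (fun i => pi ^+ i * (f (zs i)).1.2) v_complete.
    by have [_ ? _ _] := f_spec _ (zs0 k); val.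
  exists a, b; apply/eqP; rewrite -subr_eq0; apply/eqP.
  apply: (@val_ge_eq0 _ w) => k; have ak := a_lim k; have bk := b_lim k; have zk := zs0 k.
  move: (zE k); set sa := \sum_(i < k) _; set sb := \sum_(i < k) _; move=> ->.
  suff -> : sa%:E + sb%:E * x + (pi ^+ k)%:E * zs k - (a%:E + b%:E * x) =
    (pi ^+ k)%:E * zs k - (a - sa)%:E - (b - sb)%:E * x by val.
  by rewrite !rmorphB; ring.
have : (\dim {:E} <= 2)%N; last by rewrite dimE.
apply: leq_trans (dim_span [:: 1; x]); apply: dimvS.
apply/subvP => z _; have [k zk] := val_ge_ex w z.
have [|a [b zE]] := O_span ((pi ^+ k)%:E * z); first by val.
have pik0 : pi ^+ k != 0 by rewrite expf_neq0 //; case: pi_unif.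
have -> : z = (pi ^+ k)^-1 *: (a *: 1 + b *: x).
  rewrite -[b *: x]mulr_algl -zE in_algE mulr_algl scalerA mulVf ?scale1r //.
by rewrite memvZ // memvD // memvZ // memv_span // !inE eqxx ?orbT.
Qed.

Lemma lin_inj y c0 c1 c2 d0 d1 d2 : integral_generator y ->
  lin y c0 c1 c2 = lin y d0 d1 d2 -> [/\ c0 = d0, c1 = d1 & c2 = d2].
Proof.
move=> y_gen eq_lin.
have sub_ge m : [/\ val_ge v m (c0 - d0), val_ge v m (c1 - d1) & val_ge v m (c2 - d2)].
  apply: (ig_coord y_gen).
  suff -> : lin y (c0 - d0) (c1 - d1) (c2 - d2) = 0 by left.
  rewrite -(subrr (lin y c0 c1 c2)) {2}eq_lin /lin !rmorphB; ring.
by split; apply/eqP; rewrite -subr_eq0; apply/eqP; apply: (@val_ge_eq0 _ v) => k;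
  have [] := sub_ge k%:Z.
Qed.

(** * The generators [a x + b x^2] *)

Definition primitive a b : Prop :=
  [/\ val_ge v 0 a, val_ge v 0 b & ~ (val_ge v 1 a /\ val_ge v 1 b)].

Definition plin x a b : E := a%:E * x + b%:E * x ^+ 2.

Lemma val_ge_plin x a b : val_ge w 0 x -> val_ge v 0 a -> val_ge v 0 b ->
  val_ge w 0 (plin x a b).
Proof. by move=> x0 a0 b0; rewrite /plin; val. Qed.

(* With [x^3 = al x^2 + be x + ga] and [d = a + b al], the determinant of
   [1, y, y^2] in the basis [1, x, x^2], for [y = a x + b x^2], is the norm of
   [d - b x]; it is computed here as the product of [d - b x] with its
   cofactor, neither of which is divisible by [pi]. *)
Lemma plin_generator x a b : \dim {:E}%VS = 3%N -> integral_generator x ->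
  primitive a b -> integral_generator (plin x a b).
Proof.
move=> dimE x_gen [a0 b0 ab_prim]; have x0 := ig_integral x_gen.
have [ga [be [al x3]]] := ig_span x_gen (x ^+ 3).
have [ga0 be0 al0] : [/\ val_ge v 0 ga, val_ge v 0 be & val_ge v 0 al].
  by apply: (ig_coord x_gen); rewrite -x3; apply: val_ge_exp.
have x3_0 : x ^+ 3 - lin x ga be al = 0 by rewrite x3 subrr.
pose d := a + b * al.
have d0 : val_ge v 0 d by rewrite /d; val.
pose N := d ^+ 3 - al * d ^+ 2 * b - be * d * b ^+ 2 - ga * b ^+ 3.
have N_unit : ~ val_ge v 1 N.
  move=> N1.
  have cof_div :
    ~ val_ge w 1 (lin x (d ^+ 2 - al * b * d - be * b ^+ 2) (b * (d - al * b)) (b ^+ 2)).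
    move=> /(ig_coord x_gen)[dd _ bb].
    have b1 : val_ge v 1 b by have [] := val_ge_prime v_val b0 b0 bb.
    have d2 : val_ge v 1 (d * d).
      suff -> : d * d = d ^+ 2 - al * b * d - be * b ^+ 2 + (al * d * b + be * b * b) by val.
      by ring.
    have d1 : val_ge v 1 d by have [] := val_ge_prime v_val d0 d0 d2.
    apply: ab_prim; split=> //; suff -> : a = d - b * al by val.
    by rewrite /d; ring.
  have lin_div : ~ val_ge w 1 (lin x d (- b) 0).
    move=> /(ig_coord x_gen)[d1 /(val_geN v_val)]; rewrite opprK => b1 _.
    apply: ab_prim; split=> //; suff -> : a = d - b * al by val.
    by rewrite /d; ring.
  case: (@val_ge_prime _ _ w_val (lin x d (- b) 0)
    (lin x (d ^+ 2 - al * b * d - be * b ^+ 2) (b * (d - al * b)) (b ^+ 2))) => //.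
  - by apply: val_ge_lin; val.
  - by apply: val_ge_lin; val.
  suff -> : lin x d (- b) 0 * lin x (d ^+ 2 - al * b * d - be * b ^+ 2) (b * (d - al * b)) (b ^+ 2)
    = N%:E - (b ^+ 3)%:E * (x ^+ 3 - lin x ga be al) by rewrite x3_0 mulr0 subr0; val.
  by rewrite /N /lin; ring.
(* Coordinates of [(a x + b x^2)^2]; doubled terms are written as sums, a form that [val] can
   bound. *)
pose y0 := a * b * ga + a * b * ga + b ^+ 2 * (al * ga).
pose y1 := a * b * be + a * b * be + b ^+ 2 * (al * be + ga).
pose y2 := a ^+ 2 + a * b * al + a * b * al + b ^+ 2 * (al * al + be).
have y2E : plin x a b ^+ 2 = lin x y0 y1 y2.
  suff -> : plin x a b ^+ 2 = lin x y0 y1 y2 +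
    ((b ^+ 2)%:E * x + (a * b + a * b + b ^+ 2 * al)%:E) * (x ^+ 3 - lin x ga be al).
    by rewrite x3_0 mulr0 addr0.
  by rewrite /plin /lin /y0 /y1 /y2; ring.
apply: integral_generatorP => //; first exact: val_ge_plin.
move=> c0 c1 c2 c00 c10 c20 lin1.
have [e0 e1 e2] : [/\ val_ge v 1 (c0 + c2 * y0), val_ge v 1 (c1 * a + c2 * y1) &
    val_ge v 1 (c1 * b + c2 * y2)].
  apply: (ig_coord x_gen).
  suff -> : lin x (c0 + c2 * y0) (c1 * a + c2 * y1) (c1 * b + c2 * y2) =
    lin (plin x a b) c0 c1 c2 by [].
  by rewrite [in RHS]/lin y2E /plin /lin; ring.
have y00 : val_ge v 0 y0 by rewrite /y0; val.
have y10 : val_ge v 0 y1 by rewrite /y1; val.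
have y20 : val_ge v 0 y2 by rewrite /y2; val.
(* Cramer's rule for the last two congruences: [N = a y2 - b y1] is their determinant. *)
have c1_1 : val_ge v 1 c1.
  apply: (val_ge_unit_cancel v_val N_unit).
  suff -> : N * c1 = y2 * (c1 * a + c2 * y1) - y1 * (c1 * b + c2 * y2) by val.
  by rewrite /N /y1 /y2 /d; ring.
have c2_1 : val_ge v 1 c2.
  apply: (val_ge_unit_cancel v_val N_unit).
  suff -> : N * c2 = a * (c1 * b + c2 * y2) - b * (c1 * a + c2 * y1) by val.
  by rewrite /N /y1 /y2 /d; ring.
split=> //; suff -> : c0 = c0 + c2 * y0 - c2 * y0 by val.
by ring.
Qed.

(** * The lattices between [o] and [O_E] *)

(* [o + pi^e o y + pi^f O_E] *)
Definition lattice (y : E) (e f : nat) : set E := [set z | exists c0 c1 b,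
  [/\ val_ge v 0 c0, val_ge v e%:Z c1, val_ge w f%:Z b & z = c0%:E + c1%:E * y + b]].

Local Notation o := (@base_integers F E v).

Lemma base_integersE c : val_ge v 0 c -> o c%:E.
Proof. by move=> c0; exists c. Qed.

Lemma base_integersP z : o z -> exists2 c, val_ge v 0 c & z = c%:E.
Proof. by case=> c c0 <-; exists c. Qed.

Lemma is_subring_o : is_subring o.
Proof.
split; first by rewrite -(rmorph1 (in_alg E)); apply: base_integersE; val.
- move=> _ _ /base_integersP[a a0 ->] /base_integersP[b b0 ->].
  by rewrite -rmorphB; apply: base_integersE; val.
- move=> _ _ /base_integersP[a a0 ->] /base_integersP[b b0 ->].
  by rewrite -rmorphM; apply: base_integersE; val.
Qed.

Lemma subring_D (A : set E) a b : is_subring A -> A a -> A b -> A (a + b).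
Proof.
case=> A1 AB _ Aa Ab; have A0 : A 0 by rewrite -(subrr 1); apply: AB.
by rewrite -[b]opprK -[- b]sub0r; apply: (AB) => //; apply: AB.
Qed.

Lemma submodule_B (A M : set E) y z : is_subring A -> is_submodule A M ->
  M y -> M z -> M (y - z).
Proof.
case=> A1 AB _ [_ MD MZ] My Mz; apply: MD => //; rewrite -mulN1r.
by apply: MZ => //; rewrite -sub0r -(subrr 1); apply: (AB) => //; apply: AB.
Qed.

Lemma submodule_sub (A B M : set E) : A `<=` B -> is_submodule B M -> is_submodule A M.
Proof. by move=> AB [M0 MD MZ]; split=> // a y /AB; apply: MZ. Qed.

Lemma subring_submodule (A : set E) : is_subring A -> is_submodule A A.
Proof.
move=> A_ring; have [A1 AB AM] := A_ring.
split=> //; first by rewrite -(subrr 1); apply: AB.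
by move=> a b; apply: subring_D.
Qed.

Lemma submodule_lin (M : set E) y c0 c1 c2 : is_submodule o M ->
  val_ge v 0 c0 -> val_ge v 0 c1 -> val_ge v 0 c2 ->
  M 1 -> M y -> M (y ^+ 2) -> M (lin y c0 c1 c2).
Proof.
move=> [_ MD MZ] c00 c10 c20 M1 My My2; rewrite /lin -[c0%:E]mulr1.
by apply: (MD); [apply: (MD) |]; apply: MZ => //; apply: base_integersE.
Qed.

(** [pi^f O_E] splits along [1, y, y^2], and its first two parts are absorbed because
    [0 <= e <= f]. *)
Lemma lattice_lin y e f c0 c1 c2 : integral_generator y -> (e <= f)%N ->
  lattice y e f (lin y c0 c1 c2) <->
  [/\ val_ge v 0 c0, val_ge v e%:Z c1 & val_ge v f%:Z c2].
Proof.
move=> y_gen le_ef; have y0 := ig_integral y_gen; split.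
  move=> [a0 [a1 [b [a00 a1e bf]]]]; have [b0 [b1 [b2 bE]]] := ig_span y_gen b.
  have [b0f b1f b2f] : [/\ val_ge v f%:Z b0, val_ge v f%:Z b1 & val_ge v f%:Z b2].
    by apply: (ig_coord y_gen); rewrite -bE.
  move=> eq_lin; have [-> -> ->] : [/\ c0 = a0 + b0, c1 = a1 + b1 & c2 = b2].
    by apply: (lin_inj y_gen); rewrite eq_lin bE /lin; ring.
  by split=> //; val.
move=> [c00 c1e c2f]; exists c0, c1, (c2%:E * y ^+ 2); split=> //; val.
Qed.

Lemma lattice_pi_y y e f : lattice y e f ((pi ^+ e)%:E * y).
Proof. by exists 0, (pi ^+ e), 0; split; rewrite ?rmorph0 ?add0r ?addr0 //; val. Qed.

Lemma lattice_val_ge y e f b : val_ge w f%:Z b -> lattice y e f b.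
Proof. by move=> bf; exists 0, 0, b; split; rewrite ?rmorph0 ?mul0r ?add0r //; left. Qed.

Lemma lattice_1 y e f : lattice y e f 1.
Proof.
exists 1, 0, 0; split; rewrite ?rmorph1 ?rmorph0 ?mul0r ?addr0 //; by [left | val].
Qed.

Lemma lattice_integral y e f z : val_ge w 0 y -> lattice y e f z -> val_ge w 0 z.
Proof. by move=> y0 [c0 [c1 [b [c00 c1e bf ->]]]]; val. Qed.

Lemma lattice_submodule y e f : is_submodule o (lattice y e f).
Proof.
split; first by apply: lattice_val_ge; left.
- move=> _ _ [a0 [a1 [a [a00 a1e af ->]]]] [b0 [b1 [b [b00 b1e bf ->]]]].
  exists (a0 + b0), (a1 + b1), (a + b); split; [val|val|val|].
  by rewrite !rmorphD; ring.
- move=> _ _ /base_integersP[t t0 ->] [b0 [b1 [b [b00 b1e bf ->]]]].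
  exists (t * b0), (t * b1), (t%:E * b); split; [val|val|val|].
  by rewrite !rmorphM; ring.
Qed.

(** The critical term is [a1 b1 y^2], which lies in [pi^(e + e') O_E]. Taking [e' = e] gives
    products in an order, and [e' = f - e] the action on the ideal that tests the Gorenstein
    property. *)
Lemma lattice_mul y e e' f z z' : val_ge w 0 y -> (f <= e + e')%N -> (e' <= e)%N ->
  lattice y e f z -> lattice y e' f z' -> lattice y e' f (z * z').
Proof.
move=> y0 le_f le_e [a0 [a1 [a [a00 a1e af ->]]]] [b0 [b1 [b [b00 b1e bf ->]]]].
exists (a0 * b0), (a0 * b1 + a1 * b0),
  ((a1 * b1)%:E * y ^+ 2 + a * (b0%:E + b1%:E * y + b) + (a0%:E + a1%:E * y) * b).
split; [val | val | | by rewrite rmorphD !rmorphM; ring].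
have a' : val_ge w 0 (a0%:E + a1%:E * y) by val.
have b' : val_ge w 0 (b0%:E + b1%:E * y + b) by val.
val.
Qed.

Lemma lattice_subringP y e f : integral_generator y -> (e <= f)%N ->
  is_subring (lattice y e f) <-> (f <= 2 * e)%N.
Proof.
move=> y_gen le_ef; have y0 := ig_integral y_gen; split=> [[_ _ latM]|le_f2e].
  have := latM _ _ (lattice_pi_y y e f) (lattice_pi_y y e f).
  have -> : (pi ^+ e)%:E * y * ((pi ^+ e)%:E * y) = lin y 0 0 (pi ^+ (2 * e)).
    by rewrite /lin mul2n -addnn exprD; ring.
  move/(lattice_lin _ _ _ y_gen le_ef)=> [_ _].
  have [pi0 _] := pi_unif.
  move/(val_ge_valuation (expf_neq0 _ pi0)); rewrite uniformizer_exp //; lia.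
split; first exact: lattice_1.
  by move=> y1 y2; apply: submodule_B is_subring_o (lattice_submodule y e f).
by move=> z z'; apply: lattice_mul => //; lia.
Qed.

(** Expanding [y] in powers of [y'] reduces the inclusion to valuations of [d1] and [d2]. The last
    clause makes a strict inclusion lower an exponent, which drives the length count. *)
Lemma lattice_sub y y' e f e' f' : integral_generator y -> integral_generator y' ->
  (e <= f)%N -> (e' <= f')%N -> lattice y e f `<=` lattice y' e' f' ->
  [/\ (e' <= e)%N, (f' <= f)%N &
    e = e' -> f = f' -> lattice y e f = lattice y' e' f'].
Proof.
move=> y_gen y'_gen le_ef le_ef' sub_lat; have y0 := ig_integral y_gen.
have y'0 := ig_integral y'_gen; have [pi0 _] := pi_unif.
have le_f : (f' <= f)%N.
  have : lattice y e f (lin y' 0 0 (pi ^+ f)).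
    by apply: lattice_val_ge; apply: val_ge_lin; val.
  move/sub_lat/(lattice_lin _ _ _ y'_gen le_ef') => [_ _].
  by move/(val_ge_valuation (expf_neq0 _ pi0)); rewrite uniformizer_exp //; lia.
have [d0 [d1 [d2 yE]]] := ig_span y'_gen y.
have [d00 d10 d20] : [/\ val_ge v 0 d0, val_ge v 0 d1 & val_ge v 0 d2].
  by apply: (ig_coord y'_gen); rewrite -yE.
have [_ d1e' d2f'] : [/\ val_ge v 0 (pi ^+ e * d0), val_ge v e'%:Z (pi ^+ e * d1) &
    val_ge v f'%:Z (pi ^+ e * d2)].
  apply/(lattice_lin _ _ _ y'_gen le_ef').
  suff -> : lin y' (pi ^+ e * d0) (pi ^+ e * d1) (pi ^+ e * d2) = (pi ^+ e)%:E * y.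
    by apply: sub_lat; apply: lattice_pi_y.
  by rewrite yE /lin !rmorphM; ring.
(* Otherwise [y] would be congruent to [d0] modulo [pi], against [y_gen]. *)
have d_prim : ~ (val_ge v 1 d1 /\ val_ge v 1 d2).
  move=> [d11 d21];
  have /(ig_coord y_gen)[_ /(not_val_ge_1_1 v_val)//] : val_ge w 1 (lin y (- d0) 1 0).
  suff -> : lin y (- d0) 1 0 = d1%:E * y' + d2%:E * y' ^+ 2 by val.
  by rewrite /lin [in LHS]yE /lin; ring.
have vpie : v (pi ^+ e) <= e%:Z by rewrite uniformizer_exp.
have pie0 := expf_neq0 e pi0.
have le_e : (e' <= e)%N.
  rewrite leqNgt; apply/negP => lt_e; apply: d_prim; split;
    by apply: (val_ge_cancel v_val pie0 vpie); apply: val_geW; [eassumption | lia].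
split=> // eq_e eq_f; apply/seteqP; split=> //.
move=> _ [c0 [c1 [b [c00 c1e bf ->]]]].
(* For [e = f] both lattices are [o + pi^f O_E]. *)
have [eq_ef|lt_ef] : e = f \/ (e < f)%N by lia.
  exists c0, 0, (c1%:E * y' + b); split=> //; [by left | val |].
  by rewrite rmorph0; ring.
have d2fe : val_ge v (f%:Z - e%:Z) d2.
  by apply: (val_ge_cancel v_val pie0 vpie); apply: val_geW; [eassumption | lia].
have d1u : ~ val_ge v 1 d1 by move=> d11; apply: d_prim; split=> //; val.
have d1V := val_ge_unitV v_val d1u; have d1n0 := not_val_ge_neq0 d1u.
(* Solve [y = d0 + d1 y' + d2 y'^2] for [y']; the term in [d2] falls into [pi^f O_E]. *)
exists (c0 - c1 * d0 / d1), (c1 / d1), (b - (c1 * d2 / d1)%:E * y' ^+ 2).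
split; [val | val | val |].
have e1 : (d1^-1)%:E * d1%:E = 1 by rewrite -rmorphM mulVf // rmorph1.
rewrite -[c1%:E * y']mulr1 -[in LHS]e1 yE /lin rmorphB !rmorphM; ring.
Qed.

Lemma val_ge_factor k c : val_ge v k%:Z c -> exists2 d, val_ge v 0 d & c = pi ^+ k * d.
Proof. by move/(principal_idealE v_val _ _ pi_unif). Qed.

Lemma val_ge_factorE k z : val_ge w k%:Z z ->
  exists2 b, val_ge w 0 b & z = (pi ^+ k)%:E * b.
Proof. by rewrite rmorphXn; move/(principal_idealE w_val _ _ uniformizer_alg). Qed.

(* [f] is the least exponent with [pi^f O_E] inside [M], and [e] is the largest
   exponent, at most [f], with [M] inside [o + pi^e O_E]. *)
Lemma submodule_lattice x M N : \dim {:E}%VS = 3%N -> integral_generator x ->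
  is_submodule o M -> M 1 -> M `<=` ring_of_integers w ->
  (forall b, val_ge w N%:Z b -> M b) ->
  exists a b e f, [/\ primitive a b, (e <= f)%N & M = lattice (plin x a b) e f].
Proof.
move=> dimE x_gen M_mod M1 M_int M_N; have [M0 MD MZ] := M_mod.
have x0 := ig_integral x_gen; have [pi0 vpi] := pi_unif.
have Mo c : val_ge v 0 c -> M c%:E.
  by move=> c0; rewrite -[c%:E]mulr1; apply: MZ => //; apply: base_integersE.
have MB := submodule_B is_subring_o M_mod.
have MZF c z : val_ge v 0 c -> M z -> M (c%:E * z).
  by move=> c0; apply: MZ; apply: base_integersE.
pose P k := `[< forall b, val_ge w k%:Z b -> M b >].
have exP : exists k, P k by exists N; apply/asboolP.
case: (ex_minnP exP) => f /asboolP M_f f_min.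
pose Q k := (k <= f)%N &&
  `[< forall z, M z -> exists2 c, val_ge v 0 c & val_ge w k%:Z (z - c%:E) >].
have exQ : exists k, Q k.
  exists 0%N; rewrite /Q leq0n; apply/asboolP => z /M_int z0.
  by exists 0; [left | rewrite (rmorph0 (in_alg E)) subr0].
have leQ k : Q k -> (k <= f)%N by case/andP.
case: (ex_maxnP exQ leQ) => e /andP[le_ef /asboolP M_e] e_max.
have [eq_ef|lt_ef] : e = f \/ (e < f)%N by lia.
  (* [M] is then [o + pi^f O_E], whatever [y] is; [y = x] is taken. *)
  exists 1, 0, f, f; split=> //.
    by split; [val | val | case=> /(not_val_ge_1_1 v_val)].
  rewrite eq_ef in M_e; apply/seteqP; split=> [z /M_e[c c0 zf]|].
    exists c, 0, (z - c%:E); split=> //; [by left | by rewrite rmorph0; ring].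
  move=> _ [c0 [c1 [b [c00 c1f bf ->]]]]; rewrite -addrA.
  apply: (MD); [exact: Mo | apply: M_f].
  have y0 : val_ge w 0 (plin x 1 0) by apply: val_ge_plin; val.
  by val.
(* Maximality of [e] gives [z] in [M] outside [o + pi^(e+1) O_E]; removing its constant part and
   dividing by [pi^e] yields [y]. *)
have [z Mz z_e1] : exists2 z, M z & forall c, val_ge v 0 c -> ~ val_ge w e.+1%:Z (z - c%:E).
  apply: contrapT => no_z.
  suff /e_max : Q e.+1 by rewrite ltnn.
  rewrite /Q lt_ef; apply/asboolP => z Mz; apply: contrapT => no_c.
  by apply: no_z; exists z => // c c0 zc; apply: no_c; exists c.
have [c c0 /val_ge_factorE[z' z'0 zE]] := M_e _ Mz.
have [z0 [z1 [z2 z'E]]] := ig_span x_gen z'.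
have [z00 z10 z20] : [/\ val_ge v 0 z0, val_ge v 0 z1 & val_ge v 0 z2].
  by apply: (ig_coord x_gen); rewrite -z'E.
have z_prim : primitive z1 z2.
  split=> // -[z11 z21]; apply: (z_e1 (c + pi ^+ e * z0)); first by val.
  suff -> : z - (c + pi ^+ e * z0)%:E = (pi ^+ e)%:E * (z1%:E * x + z2%:E * x ^+ 2) by val.
  by rewrite rmorphD opprD addrA zE z'E /lin rmorphM; ring.
have y_gen := plin_generator dimE x_gen z_prim.
set y := plin x z1 z2 in y_gen; have y0 := ig_integral y_gen.
exists z1, z2, e, f; split=> //; rewrite -/y.
have My : M ((pi ^+ e)%:E * y).
  suff -> : (pi ^+ e)%:E * y = z - (c + pi ^+ e * z0)%:E.
    by apply: MB => //; apply: Mo; val.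
  by rewrite rmorphD opprD addrA zE z'E /lin /y /plin rmorphM; ring.
have Mye d : val_ge v e%:Z d -> M (d%:E * y).
  case/val_ge_factor => d' d'0 ->.
  suff -> : (pi ^+ e * d')%:E * y = d'%:E * ((pi ^+ e)%:E * y) by apply: MZF.
  by rewrite rmorphM; ring.
apply/seteqP; split=> [m Mm|]; last first.
  move=> _ [c0' [c1 [b [c00 c1e bf ->]]]].
  by apply: (MD); [apply: (MD); [apply: Mo | apply: Mye] | apply: M_f].
have [d d0 md] := M_e _ Mm; have [m0 [m1 [m2 mE]]] := ig_span y_gen (m - d%:E).
have [m0e m1e m2e] : [/\ val_ge v e%:Z m0, val_ge v e%:Z m1 & val_ge v e%:Z m2].
  by apply: (ig_coord y_gen); rewrite -mE.
have m00 : val_ge v 0 m0 by val.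
have My2 : M (m2%:E * y ^+ 2).
  suff -> : m2%:E * y ^+ 2 = m - d%:E - m0%:E - m1%:E * y.
    by apply: (MB); [apply: (MB); [apply: (MB) |] |]; auto.
  by rewrite mE /lin; ring.
suff m2f : val_ge v f%:Z m2.
  exists (d + m0), m1, (m2%:E * y ^+ 2); split=> //; [val | val |].
  by rewrite -[LHS](subrK d%:E) mE /lin; ring.
(* A [y^2]-coordinate [m2] of valuation [g < f] would put all of [pi^g O_E] inside [M], against the
   minimality of [f]. *)
apply: contrapT => m2_f; have m2n0 := not_val_ge_neq0 m2_f.
have := val_ge_valuation m2n0 m2e => vm2.
have [g vg] : exists g : nat, v m2 = g%:Z by exists `|v m2|%N; lia.
have lt_gf : ~ (f <= g)%N by move=> le_fg; apply: m2_f; right; lia.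
apply: lt_gf; apply: f_min; apply/asboolP => b bg.
have [b0 [b1 [b2 bE]]] := ig_span y_gen b.
have [b0g b1g b2g] : [/\ val_ge v g%:Z b0, val_ge v g%:Z b1 & val_ge v g%:Z b2].
  by apply: (ig_coord y_gen); rewrite -bE.
rewrite bE /lin; apply: (MD); first by apply: (MD); [apply: Mo | apply: Mye]; val.
suff -> : b2%:E * y ^+ 2 = (b2 / m2)%:E * (m2%:E * y ^+ 2).
  apply: (MZF) => //; have m2V : val_ge v (- g%:Z) m2^-1 by right; rewrite valuationV // vg.
  by val.
by rewrite mulrA -rmorphM divfK.
Qed.

(** * Explicit generators, orders and overorders *)

Local Notation span := Defs.span.
Lemma span3P (A : set E) u1 u2 u3 z : span A [:: u1; u2; u3] z <->
  exists a1 a2 a3, [/\ A a1, A a2, A a3 & z = a1 * u1 + a2 * u2 + a3 * u3].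
Proof.
split=> [[b Ab ->]|[a1 [a2 [a3 [A1 A2 A3 ->]]]]].
  exists (b 0), (b 1), (b 2%:R); split=> //.
  rewrite !big_ord_recl big_ord0 /= addr0 addrA.
  by congr (b _ * _ + b _ * _ + b _ * _); apply: val_inj.
exists (fun i => [:: a1; a2; a3]`_i); first by case=> [[|[|[|i]]] lti].
by rewrite !big_ord_recl big_ord0 /= addr0 addrA.
Qed.

(** [g] completes [1, y] to a basis of [O_E]: it is [y^2] in general, [x^2] for the first family and
    [x] for the second, whose generators come in the other order. *)
Lemma lattice_span y e f g : val_ge w 0 y -> val_ge w 0 g -> (e <= f)%N ->
  (forall b, val_ge w 0 b -> exists b0 b1 b2, [/\ val_ge v 0 b0, val_ge v 0 b1, val_ge v 0 b2 &
     b = b0%:E + b1%:E * y + b2%:E * g]) ->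
  lattice y e f = span o [:: 1; pi ^+ e *: y; pi ^+ f *: g].
Proof.
move=> y0 g0 le_ef yg_span; apply/seteqP; split=> z.
  move=> [c0 [c1 [b [c00 /val_ge_factor[t t0 ->] /val_ge_factorE[b' /yg_span] ]]]].
  move=> [b0 [b1 [b2 [b00 b10 b20 ->]]]] -> ->.
  apply/span3P; exists (c0 + pi ^+ f * b0)%:E, (t + pi ^+ (f - e) * b1)%:E, b2%:E.
  split; [apply: base_integersE; val|apply: base_integersE; val|exact: base_integersE|].
  have pif : pi ^+ f = pi ^+ e * pi ^+ (f - e) by rewrite -exprD subnKC.
  by rewrite -[_ *: y]mulr_algl -[_ *: g]mulr_algl -!in_algE pif; ring.
case/span3P=> [a0 [a1 [a2 [/base_integersP[c0 c00 ->] /base_integersP[c1 c10 ->] ]]]].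
case/base_integersP=> c2 c20 -> ->.
exists c0, (c1 * pi ^+ e), (c2%:E * (pi ^+ f)%:E * g); split; [val|val|val|].
by rewrite -[_ *: y]mulr_algl -[_ *: g]mulr_algl -!in_algE; ring.
Qed.

Lemma lattice_span_power y e f : integral_generator y -> (e <= f)%N ->
  lattice y e f = span o [:: 1; pi ^+ e *: y; pi ^+ f *: y ^+ 2].
Proof.
move=> y_gen le_ef; have y0 := ig_integral y_gen; apply: lattice_span => //; first by val.
move=> b b0; have [b0' [b1 [b2 bE]]] := ig_span y_gen b.
exists b0', b1, b2; rewrite -/(lin _ _ _ _) -bE.
by have [] : [/\ val_ge v 0 b0', val_ge v 0 b1 & val_ge v 0 b2]
  by apply: (ig_coord y_gen); rewrite -bE.
Qed.

Lemma lattice_order1 x n s f c : integral_generator x -> (s - f <= f)%N -> val_ge v 0 c ->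
  order1 v pi x n s f c = lattice (plin x 1 (c * pi ^+ (f - minn n f))) (s - f) f.
Proof.
move=> x_gen le_ef c0; have x0 := ig_integral x_gen; set be := c * _.
have be0 : val_ge v 0 be by rewrite /be; val.
rewrite (lattice_span (g := x ^+ 2)) //; [|by apply: val_ge_plin; val|by val|].
  by rewrite /order1 /plin -/be rmorph1 mul1r in_algE mulr_algl.
move=> b; have [b0 [b1 [b2 ->]]] := ig_span x_gen b.
move=> /(ig_coord x_gen)[b00 b10 b20]; exists b0, b1, (b2 - b1 * be); split=> //; first by val.
by rewrite /lin /plin; ring.
Qed.

Lemma lattice_order2 x s f c : integral_generator x -> (s - f <= f)%N -> val_ge v 0 c ->
  order2 v pi x s f c = lattice (plin x (c * pi) 1) (s - f) f.
Proof.
move=> x_gen le_ef c0; have x0 := ig_integral x_gen; set a := c * pi.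
have pi1 : val_ge v 1 pi by right; case: pi_unif => _ ->.
have a0 : val_ge v 0 a by rewrite /a; val.
rewrite (lattice_span (g := x)) //; [|by apply: val_ge_plin; val|].
  apply/seteqP; split=> z /span3P[a1 [a2 [a3 [oa1 oa2 oa3 ->]]]]; apply/span3P;
    exists a1, a3, a2; split=> //; rewrite /plin rmorph1 mul1r in_algE mulr_algl -/a; ring.
move=> b; have [b0 [b1 [b2 ->]]] := ig_span x_gen b.
move=> /(ig_coord x_gen)[b00 b10 b20]; exists b0, b2, (b1 - b2 * a); split=> //; first by val.
by rewrite /lin /plin; ring.
Qed.

Lemma is_order_lattice y e f : integral_generator y -> (e <= f)%N ->
  is_order v (lattice y e f) <-> (f <= 2 * e)%N.
Proof.
move=> y_gen le_ef; split=> [[/(lattice_subringP y_gen le_ef)]//|le_f2e].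
split; first exact/(lattice_subringP y_gen le_ef).
- move=> _ /base_integersP[c c0 ->]; exists c, 0, 0.
  by rewrite (rmorph0 (in_alg E)) mul0r !addr0; split=> //; left.
- by exists [:: 1; pi ^+ e *: y; pi ^+ f *: y ^+ 2]; apply: lattice_span_power.
apply/seteqP; split=> // z _; have [k zk] := val_ge_ex w z.
have pik0 : pi ^+ (k + f) != 0 by rewrite expf_neq0 //; case: pi_unif.
(* [pi^(k + f) z] already lies in [pi^f O_E], so a single product suffices. *)
exists 1%N, (fun=> ((pi ^+ (k + f))^-1)%:E), (fun=> (pi ^+ (k + f))%:E * z); split.
- by move=> _; exists (pi ^+ (k + f))^-1.
- by move=> _; apply: lattice_val_ge; val.
by rewrite big_ord1 mulrA -rmorphM mulVf // rmorph1 mul1r.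
Qed.

Lemma adjoin_integers_sub z (O : set E) : is_subring O -> o `<=` O ->
  adjoin_integers v z `<=` O <-> O z.
Proof.
move=> O_ring oO; split=> [sub_O|Oz].
  apply: sub_O; exists 'X; last by rewrite horner_algX.
  by move=> i; rewrite coefX; case: (i == 1%N); [exact: val_ge_1 | left].
move=> _ [p p0 ->]; elim/poly_ind: p p0 => [|p c IHp] pc0.
  by rewrite rmorph0; have [O1 OB _] := O_ring; rewrite -(subrr 1); apply: OB.
rewrite rmorphD rmorphM /= horner_algX horner_algC; apply: subring_D => //.
  have [_ _ OM] := O_ring; apply: OM => //; apply: IHp => i.
  by have := pc0 i.+1; rewrite coefD coefMX coefC addr0.
by apply: oO; exists c => //; have := pc0 0%N; rewrite coefD coefMX coefC add0r.
Qed.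

Lemma overorder_lattice x n y e f : integral_generator y -> (e <= f)%N ->
  is_overorder v (adjoin_integers v (pi ^+ n *: x)) (lattice y e f) <->
  (f <= 2 * e)%N /\ lattice y e f ((pi ^+ n)%:E * x).
Proof.
move=> y_gen le_ef; rewrite in_algE mulr_algl; split.
  case=> L_order R_L; split; first exact/(is_order_lattice y_gen le_ef).
  by have [L_ring oL _ _] := L_order; apply/(adjoin_integers_sub _ L_ring oL).
move=> [le_f2e L_x]; have L_order := proj2 (is_order_lattice y_gen le_ef) le_f2e.
by split=> //; have [L_ring oL _ _] := L_order; apply/(adjoin_integers_sub _ L_ring oL).
Qed.

(** Compare the coordinates on [x] and [x^2]; for [t = pi^n] this decides whether a lattice that is
    a ring contains [R]. *)
Lemma lattice_plin x a b e f t : \dim {:E}%VS = 3%N -> integral_generator x ->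
  primitive a b -> (e <= f)%N -> val_ge v 0 t ->
  lattice (plin x a b) e f (t%:E * x) <->
  exists c, [/\ val_ge v e%:Z c, val_ge v f%:Z (t - c * a) & val_ge v f%:Z (c * b)].
Proof.
move=> dimE x_gen ab_prim le_ef t0; have x0 := ig_integral x_gen; split.
  move=> [c0 [c [d [c00 ce df xE]]]]; exists c.
  have [_ tca /(val_geN v_val)] : [/\ val_ge v f%:Z (- c0),
      val_ge v f%:Z (t - c * a) & val_ge v f%:Z (- (c * b))].
    apply: (ig_coord x_gen).
    suff -> : lin x (- c0) (t - c * a) (- (c * b)) = d by [].
    suff -> : d = t%:E * x - c0%:E - c%:E * plin x a b by rewrite /lin /plin; ring.
    by rewrite xE; ring.
  by rewrite opprK.
move=> [c [ce tca cb]]; exists 0, c, ((t - c * a)%:E * x - (c * b)%:E * x ^+ 2).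
split=> //; [by left | by val | by rewrite /plin (rmorph0 (in_alg E)); ring].
Qed.

Lemma finitely_generated_bounded (A M : set E) : A `<=` ring_of_integers w ->
  finitely_generated A M -> exists k : nat, forall z, M z -> val_ge w (- k%:Z) z.
Proof.
move=> A_int [us ->].
have [k us_k] : exists k : nat, forall z, z \in us -> val_ge w (- k%:Z) z.
  elim: us => [|u us [k us_k]]; first by exists 0%N.
  have [l ul] := val_ge_ex w u; exists (k + l)%N => z; rewrite inE.
  by case/orP=> [/eqP->|/us_k zk]; val.
exists k => _ [b ob ->]; apply: val_ge_sum => // i.
have bi0 : val_ge w 0 (b i) := A_int _ (ob i).
by have uik := us_k _ (mem_nth 0 (ltn_ord i)); val.
Qed.

(** The powers of an element stay in a finitely generated module, so their valuations are bounded
    below: [(k + 1) w z >= - k] forces [w z >= 0]. *)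
Lemma order_integral (O : set E) : is_order v O -> O `<=` ring_of_integers w.
Proof.
case=> -[O1 _ OM] _ O_fg _ z Oz.
have o_int : o `<=` ring_of_integers w.
  by move=> _ /base_integersP[c c0 ->]; rewrite /ring_of_integers; val.
have [k O_k] := finitely_generated_bounded o_int O_fg.
have O_exp i : O (z ^+ i) by elim: i => [|i IHi]; rewrite ?expr0 // exprS; apply: OM.
have [->|z0] := eqVneq z 0; first by left.
right; have := val_ge_valuation (expf_neq0 _ z0) (O_k _ (O_exp k.+1)).
by rewrite valuationX //; nia.
Qed.

Lemma overorder_plin x n O : \dim {:E}%VS = 3%N -> integral_generator x ->
  is_overorder v (adjoin_integers v (pi ^+ n *: x)) O ->
  exists a b e f, [/\ primitive a b, (e <= f)%N & O = lattice (plin x a b) e f].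
Proof.
move=> dimE x_gen [O_order R_O]; have [O_ring oO _ _] := O_order.
have Ox : O ((pi ^+ n)%:E * x).
  by rewrite in_algE mulr_algl; apply/(adjoin_integers_sub _ O_ring oO).
have O_mod := submodule_sub oO (subring_submodule O_ring).
have [O1 _ OM] := O_ring.
(* The exponent [n + n] works because [1], [pi^n x] and [(pi^n x)^2] lie in [O]. *)
apply: (@submodule_lattice _ _ (n + n)%N) => //; first exact: order_integral.
move=> b b_nn; have [b0 [b1 [b2 bE]]] := ig_span x_gen b.
have [b0n b1n b2n] : [/\ val_ge v (n + n)%:Z b0, val_ge v (n + n)%:Z b1 & val_ge v (n + n)%:Z b2].
  by apply: (ig_coord x_gen); rewrite -bE.
have pin0 : pi ^+ n != 0 by rewrite expf_neq0 //; case: pi_unif.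
have pinV : val_ge v (- n%:Z) (pi ^+ n)^-1.
  by right; rewrite valuationV // uniformizer_exp.
have -> : b = lin ((pi ^+ n)%:E * x) b0 (b1 / pi ^+ n) (b2 / (pi ^+ n) / pi ^+ n).
  rewrite bE /lin.
  have e : ((pi ^+ n)^-1)%:E * (pi ^+ n)%:E = 1 by rewrite -rmorphM mulVf // rmorph1.
  rewrite -[b1%:E]mulr1 -[b2%:E]mulr1 -[b2%:E * 1]mulr1 -!e !rmorphM; ring.
apply: submodule_lin => //; [val|val|val|].
by rewrite expr2; apply: OM.
Qed.

(** * Normal forms, length and conductor *)

Lemma lattice_scale y e f t : val_ge v 0 t -> ~ val_ge v 1 t ->
  lattice (t%:E * y) e f = lattice y e f.
Proof.
move=> t0 tu; have tV := val_ge_unitV v_val tu; have tn0 := not_val_ge_neq0 tu.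
apply/seteqP; split=> _ [c0 [c1 [b [c00 c1e bf ->]]]].
  by exists c0, (c1 * t), b; split=> //; [val | rewrite rmorphM; ring].
exists c0, (c1 / t), b; split=> //; first by val.
by rewrite mulrA -rmorphM divfK.
Qed.

Lemma lattice_congr y y' e f : val_ge w (f%:Z - e%:Z) (y - y') ->
  lattice y e f = lattice y' e f.
Proof.
suff sub z z' : val_ge w (f%:Z - e%:Z) (z - z') -> lattice z e f `<=` lattice z' e f.
  move=> yy'; apply/seteqP; split; apply: sub => //.
  by rewrite -[y' - y]opprB; apply: val_geN.
move=> zz' _ [c0 [c1 [b [c00 c1e bf ->]]]].
by exists c0, c1, (b + c1%:E * (z - z')); split=> //; [val | ring].
Qed.

Lemma primitive_1l b : val_ge v 0 b -> primitive 1 b.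
Proof. by move=> b0; split; [val | | case=> /(not_val_ge_1_1 v_val)]. Qed.

Lemma primitive_1r a : val_ge v 0 a -> primitive a 1.
Proof. by move=> a0; split; [| val | case=> _ /(not_val_ge_1_1 v_val)]. Qed.

(** Divide by whichever of [a], [b] is a unit. Preferring [a] leaves [pi | d] in the second form,
    which keeps the two families apart. *)
Lemma lattice_normal_form x a b e f : primitive a b ->
  (exists2 d, val_ge v 0 d & lattice (plin x a b) e f = lattice (plin x 1 d) e f) \/
  (exists2 d, val_ge v 1 d & lattice (plin x a b) e f = lattice (plin x d 1) e f).
Proof.
case=> a0 b0 ab_prim; have [a1|au] := pselect (val_ge v 1 a).
  have bu : ~ val_ge v 1 b by move=> b1; apply: ab_prim.
  have bV := val_ge_unitV v_val bu; have bn0 := not_val_ge_neq0 bu.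
  right; exists (a / b); first by val.
  rewrite -(lattice_scale (plin x (a / b) 1) e f b0 bu); congr lattice.
  have e1 : b%:E * (a / b)%:E = a%:E by rewrite -rmorphM mulrC divfK.
  by rewrite /plin -[in LHS]e1 rmorph1; ring.
have aV := val_ge_unitV v_val au; have an0 := not_val_ge_neq0 au.
left; exists (b / a); first by val.
rewrite -(lattice_scale (plin x 1 (b / a)) e f a0 au); congr lattice.
have e1 : a%:E * (b / a)%:E = b%:E by rewrite -rmorphM mulrC divfK.
by rewrite /plin -[in LHS]e1 rmorph1; ring.
Qed.

(** The vectors [pi^e (a, b)] and [c1 (a', b')] agree modulo [pi^f], and taking the determinant
    against [(a', b')] eliminates [c1]. *)
Lemma lattice_plin_eq x a b a' b' e f : integral_generator x ->
  primitive a b -> primitive a' b' -> (e <= f)%N ->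
  lattice (plin x a b) e f = lattice (plin x a' b') e f ->
  val_ge v (f%:Z - e%:Z) (a * b' - a' * b).
Proof.
move=> x_gen [a0 b0 _] [a'0 b'0 _] le_ef eq_lat; have x0 := ig_integral x_gen.
have [c0 [c1 [d [c00 c1e df eq_y]]]] : lattice (plin x a' b') e f ((pi ^+ e)%:E * plin x a b).
  by rewrite -eq_lat; apply: lattice_pi_y.
have [_ da db] : [/\ val_ge v f%:Z (- c0), val_ge v f%:Z (pi ^+ e * a - c1 * a') &
    val_ge v f%:Z (pi ^+ e * b - c1 * b')].
  apply: (ig_coord x_gen).
  suff -> : lin x (- c0) (pi ^+ e * a - c1 * a') (pi ^+ e * b - c1 * b') = d by [].
  suff -> : d = (pi ^+ e)%:E * plin x a b - c0%:E - c1%:E * plin x a' b'.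
    by rewrite /lin /plin; ring.
  by rewrite eq_y; ring.
have pie0 : pi ^+ e != 0 by rewrite expf_neq0 //; case: pi_unif.
apply: (@val_ge_cancel _ _ v_val _ e%:Z _ _ pie0); first by rewrite uniformizer_exp.
suff -> : pi ^+ e * (a * b' - a' * b) =
  b' * (pi ^+ e * a - c1 * a') - a' * (pi ^+ e * b - c1 * b') by val.
by ring.
Qed.

(* Every term of a chain above the lattice is again a lattice of this form, and
   [e + f] drops strictly along the chain. *)
Lemma lattice_colength x y e f : \dim {:E}%VS = 3%N -> integral_generator x ->
  integral_generator y -> (e <= f)%N -> has_colength v w (lattice y e f) (e + f).
Proof.
move=> dimE x_gen y_gen le_ef; have y0 := ig_integral y_gen; split.
  (* The chain first lowers [e] to 0, then [f]; truncated subtraction keeps [i - e] at 0 during the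
     first stage. *)
  pose e_ i := (e - i)%N; pose f_ i := (f - (i - e))%N.
  exists (fun i => lattice y (e_ i) (f_ i)); split.
  - by move=> i _; apply: lattice_submodule.
  - move=> i lt_i; have le_i : (e_ i <= f_ i)%N by rewrite /e_ /f_; lia.
    have le_Si : (e_ i.+1 <= f_ i.+1)%N by rewrite /e_ /f_; lia.
    split; last first.
      by move=> /(lattice_sub y_gen y_gen le_Si le_i)[]; rewrite /e_ /f_; lia.
    move=> _ [c0 [c1 [b [c00 c1e bf ->]]]]; exists c0, c1, b.
    by split=> //; [apply: val_geW c1e _ | apply: val_geW bf _]; rewrite /e_ /f_; lia.
  - by rewrite /e_ /f_ subn0 sub0n subn0.
  - by move=> z; apply: lattice_integral.
move=> C k [C_mod C_lt L_C0 Ck_O].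
have C_mono i j : (i <= j)%N -> (j <= k)%N -> C i `<=` C j.
  move=> /subnKC <-; elim: (j - i)%N => [|l IHl]; first by rewrite addn0 => _ z.
  rewrite addnS => lt_k z /(IHl (ltnW lt_k)); have [C_sub _] := C_lt _ lt_k; exact: C_sub.
suff C_lat : forall i, (i <= k)%N -> exists y' e' f', [/\ integral_generator y', (e' <= f')%N,
    C i = lattice y' e' f' & (e' + f' + i <= e + f)%N].
  by have [_ [e' [f' [_ _ _]]]] := C_lat k (leqnn k); lia.
have C_is_lat i : (i <= k)%N -> exists y' e' f', [/\ integral_generator y', (e' <= f')%N &
    C i = lattice y' e' f'].
  move=> le_ik; have L_Ci z : lattice y e f z -> C i z.
    by move/L_C0; exact: (C_mono 0%N i (leq0n i) le_ik).
  have Ci_O z : C i z -> ring_of_integers w z by move=> /(C_mono _ _ le_ik (leqnn k))/Ck_O.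
  have L_Ci_f b : val_ge w f%:Z b -> C i b by move=> bf; apply/L_Ci/lattice_val_ge.
  have Ci_1 : C i 1 by apply/L_Ci/lattice_1.
  have [a [b [e' [f' [ab_prim le_ef' ->]]]]] :=
    submodule_lattice dimE x_gen (C_mod i le_ik) Ci_1 Ci_O L_Ci_f.
  by exists (plin x a b), e', f'; split=> //; apply: plin_generator.
elim=> [|i IHi] le_ik.
  have [y' [e' [f' [y'_gen le_ef' CE]]]] := C_is_lat 0%N le_ik.
  exists y', e', f'; split=> //; rewrite CE in L_C0.
  by have [] := lattice_sub y_gen y'_gen le_ef le_ef' L_C0; lia.
have [y1 [e1 [f1 [y1_gen le_ef1 C1 le1]]]] := IHi (ltnW le_ik).
have [y' [e' [f' [y'_gen le_ef' CE]]]] := C_is_lat i.+1 le_ik.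
exists y', e', f'; split=> //.
have [] := C_lt i le_ik; rewrite C1 CE => sub_C not_sub.
have [le_e le_f eq_lat] := lattice_sub y1_gen y'_gen le_ef1 le_ef' sub_C.
have [[eq_e eq_f]|] : (e1 = e' /\ f1 = f') \/ (e' + f' < e1 + f1)%N by lia.
  by case: not_sub; rewrite eq_lat.
by lia.
Qed.

Lemma lattice_conductor y e f : integral_generator y -> (e <= f)%N ->
  has_conductor_exponent w pi (lattice y e f) f.
Proof.
move=> y_gen le_ef; have y0 := ig_integral y_gen.
have scaleE b : pi ^+ f *: b = (pi ^+ f)%:E * b by rewrite in_algE mulr_algl.
apply/seteqP; split=> [a [a0 aL]|_ [b b0 <-]]; last first.
  have b0' : val_ge w 0 b := b0; rewrite scaleE; split.
    by rewrite /ring_of_integers; val.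
  move=> d d0; have d0' : val_ge w 0 d := d0.
  by apply: lattice_val_ge; val.
suff /val_ge_factorE[b b0 ->] : val_ge w f%:Z a by exists b.
have [->|an0] := eqVneq a 0; first by left.
right; have va := val_ge_valuation an0 a0.
have [k wk] : exists k : nat, w a = k%:Z by exists `|w a|%N; lia.
have aV : val_ge w (- k%:Z) a^-1 by right; rewrite valuationV // wk.
(* As [k] is the valuation of [a], [pi^k y^2] is [a] times an integral element. *)
have : lattice y e f (lin y 0 0 (pi ^+ k)).
  suff -> : lin y 0 0 (pi ^+ k) = a * (a^-1 * ((pi ^+ k)%:E * y ^+ 2)).
    by apply: aL; rewrite /ring_of_integers; val.
  by rewrite mulVKf // /lin; ring.
move/(lattice_lin _ _ _ y_gen le_ef)=> [_ _]; have [pi0 _] := pi_unif.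
by move/(val_ge_valuation (expf_neq0 _ pi0)); rewrite uniformizer_exp // wk.
Qed.

(** * The Gorenstein condition *)

(** The valuations of nonzero elements are bounded below, so a least one exists. Dividing by [b]
    normalises an ideal to contain [1] and lie in [O_E]. *)
Lemma finitely_generated_minimal (A M : set E) : A `<=` ring_of_integers w ->
  finitely_generated A M -> (exists2 z, M z & z != 0) ->
  exists b, [/\ M b, b != 0 & forall z, M z -> val_ge w (w b) z].
Proof.
move=> A_int M_fg [z0 Mz0 z0n0]; have [k M_k] := finitely_generated_bounded A_int M_fg.
have exP : exists i : nat, `[< exists z, [/\ M z, z != 0 & w z = i%:Z - k%:Z] >].
  have wz0 := val_ge_valuation z0n0 (M_k _ Mz0).
  exists `|(w z0 + k%:Z)%R|%N; apply/asboolP; exists z0; split=> //; lia.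
case: (ex_minnP exP) => i /asboolP[b [Mb bn0 wb]] i_min; exists b; split=> // z Mz.
have [->|zn0] := eqVneq z 0; first by left.
have wz := val_ge_valuation zn0 (M_k _ Mz).
right; have : (i <= `|(w z + k%:Z)%R|)%N.
  apply: i_min; apply/asboolP; exists z; split=> //; lia.
lia.
Qed.

(* [pi^e y] belongs to [O], so it stabilizes [I = lattice y' e' (2 e)]; the
   [y'^2]-coordinate of [pi^e y * pi^e' y'] then forces [e' = e]. *)
Lemma unital_ideal_lattice y e (I : set E) : \dim {:E}%VS = 3%N -> integral_generator y ->
  is_submodule (lattice y e (2 * e)) I -> I 1 -> I `<=` ring_of_integers w ->
  multiplier_ring I `<=` lattice y e (2 * e) -> I = lattice y e (2 * e).
Proof.
move=> dimE y_gen I_mod I1 I_int I_mult; have [_ _ IM] := I_mod.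
have y0 := ig_integral y_gen; have le_e2e : (e <= 2 * e)%N by lia.
have [pi0 _] := pi_unif.
have O_I : lattice y e (2 * e) `<=` I by move=> z Oz; rewrite -[z]mulr1; apply: IM.
have I_f b : val_ge w (2 * e)%N%:Z b -> I b by move=> b2e; apply/O_I/lattice_val_ge.
have oO : o `<=` lattice y e (2 * e).
  move=> c oc; rewrite -[c]mulr1; have [_ _ OM] := lattice_submodule y e (2 * e).
  by apply: OM => //; apply: lattice_1.
have [a [b [e' [f' [ab_prim le_ef' IE]]]]] :=
  submodule_lattice dimE y_gen (submodule_sub oO I_mod) I1 I_int I_f.
have y'_gen := plin_generator dimE y_gen ab_prim; move: y'_gen IE.
set y' := plin y a b => y'_gen IE; have y'0 := ig_integral y'_gen.
rewrite IE in O_I IM *.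
have [le_e le_f eq_lat] := lattice_sub y_gen y'_gen le_e2e le_ef' O_I.
(* [pi^f' O_E] multiplies [I] into itself, hence lies in the multiplier ring. *)
have ge_f : (2 * e <= f')%N.
  have : lattice y e (2 * e) (lin y 0 0 (pi ^+ f')).
    apply: I_mult => z /I_int z0; have z0' : val_ge w 0 z := z0.
    rewrite IE; apply: lattice_val_ge.
    have : val_ge w f'%:Z (lin y 0 0 (pi ^+ f')) by apply: val_ge_lin; val.
    by move=> ?; val.
  move/(lattice_lin _ _ _ y_gen le_e2e)=> [_ _].
  by move/(val_ge_valuation (expf_neq0 _ pi0)); rewrite uniformizer_exp.
have eq_f : (2 * e)%N = f' by lia.
have [eq_e|lt_e] : e = e' \/ (e' < e)%N by lia.
  by rewrite eq_lat.
exfalso; have [d0 [d1 [d2 yE]]] := ig_span y'_gen y.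
have [d00 d10 d20] : [/\ val_ge v 0 d0, val_ge v 0 d1 & val_ge v 0 d2].
  by apply: (ig_coord y'_gen); rewrite -yE.
have [_ _ d2f'] : [/\ val_ge v 0 (pi ^+ e * d0), val_ge v e'%:Z (pi ^+ e * d1) &
    val_ge v f'%:Z (pi ^+ e * d2)].
  apply/(lattice_lin _ _ _ y'_gen le_ef').
  suff -> : lin y' (pi ^+ e * d0) (pi ^+ e * d1) (pi ^+ e * d2) = (pi ^+ e)%:E * y.
    by apply: O_I; apply: lattice_pi_y.
  by rewrite yE /lin !rmorphM; ring.
have vpi k : v (pi ^+ k) <= k%:Z by rewrite uniformizer_exp.
have d21 : val_ge v 1 d2.
  by apply: (val_ge_cancel v_val (expf_neq0 e pi0) (vpi e)); apply: val_geW; [eassumption | lia].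
have d1u : ~ val_ge v 1 d1.
  move=> d11;
  have /(ig_coord y_gen)[_ /(not_val_ge_1_1 v_val)//] : val_ge w 1 (lin y (- d0) 1 0).
  suff -> : lin y (- d0) 1 0 = d1%:E * y' + d2%:E * y' ^+ 2 by val.
  by rewrite /lin [in LHS]yE /lin; ring.
(* This is [pi^e y] times [pi^e' y'], cleared of its cubic term, which lies in [pi^f' O_E]; its last
   coordinate has valuation [e + e' < 2 e = f']. *)
have : lattice y' e' f' (lin y' 0 (pi ^+ (e + e') * d0) (pi ^+ (e + e') * d1)).
  suff -> : lin y' 0 (pi ^+ (e + e') * d0) (pi ^+ (e + e') * d1) =
      (pi ^+ e)%:E * y * ((pi ^+ e')%:E * y') - (pi ^+ e * d2)%:E * (pi ^+ e')%:E * y' * y' ^+ 2.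
    apply: submodule_B is_subring_o (lattice_submodule y' e' f') _ _.
      by apply: IM; apply: lattice_pi_y.
    by apply: lattice_val_ge; val.
  by rewrite yE /lin exprD; ring.
move/(lattice_lin _ _ _ y'_gen le_ef')=> [_ _ /val_geW d1f'].
apply: d1u; apply: (val_ge_cancel v_val (expf_neq0 (e + e') pi0) (vpi _)).
by apply: d1f'; lia.
Qed.

(** [I] is [b O], with inverse [b^-1 O], encoded as the elements that [b] multiplies into [O]. *)
Lemma principal_invertible (O I : set E) b : is_subring O -> b != 0 ->
  (forall z, I z <-> O (b^-1 * z)) -> invertible_ideal O I.
Proof.
move=> O_ring b0 IE; have [O1 _ OM] := O_ring; have bV0 : b^-1 != 0 by rewrite invr_eq0.
have [O0 OD _] := subring_submodule O_ring.
exists [set z | O (b * z)].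
  split; [split| |].
  - by rewrite /= mulr0.
  - by move=> y z /= Oy Oz; rewrite mulrDr; apply: OD.
  - by move=> a y /= Oa Oy; rewrite mulrCA; apply: OM.
  - exists [:: b^-1]; apply/seteqP; split=> [z /= Obz|_ [a Oa ->]] /=.
      by exists (fun=> b * z) => //; rewrite big_ord1 /= mulrC mulKf.
    by rewrite big_ord1 /= mulrCA divff // mulr1.
  - by exists b^-1 => //=; rewrite divff.
apply/seteqP; split=> [_ [k [a [c [Ia Oc ->]]]]|z Oz].
  apply: (big_ind O) => // i _; have := OM _ _ (proj1 (IE _) (Ia i)) (Oc i).
  by rewrite mulrCA mulrA mulVKf // mulrC.
exists 1%N, (fun=> b), (fun=> b^-1 * z); split; rewrite ?big_ord1 ?mulVKf //.
  by move=> _; apply/IE; rewrite mulVf.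
by move=> _ /=; rewrite mulVKf.
Qed.

(* If [f < 2 e], the lattice with exponents [f - e] and [f], a multiple of the
   dual of [O], has multiplier ring [O] but is not invertible. *)
Lemma lattice_gorensteinP y e f : \dim {:E}%VS = 3%N -> integral_generator y ->
  (e <= f)%N -> (f <= 2 * e)%N -> gorenstein (lattice y e f) <-> f = (2 * e)%N.
Proof.
move=> dimE y_gen le_ef le_f2e; have y0 := ig_integral y_gen; have [pi0 _] := pi_unif.
have L_ring := proj2 (lattice_subringP y_gen le_ef) le_f2e.
have vpi k : v (pi ^+ k) <= k%:Z by rewrite uniformizer_exp.
split=> [L_gor|f2e I I_frac I_mult]; last first.
  rewrite {}f2e in L_ring I_frac I_mult *.
  have L_int : lattice y e (2 * e) `<=` ring_of_integers w by move=> z; apply: lattice_integral.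
  have [[I0 ID IM] I_fg I_n0] := I_frac.
  have [b [Ib bn0 I_b]] := finitely_generated_minimal L_int I_fg I_n0.
  suff bI : [set z | I (b * z)] = lattice y e (2 * e).
    by apply: (principal_invertible L_ring bn0) => z; rewrite -bI /= mulVKf.
  apply: unital_ideal_lattice => //=; [split=> /=|by rewrite mulr1| |].
  - by rewrite mulr0.
  - by move=> z z' Iz Iz'; rewrite mulrDr; apply: ID.
  - by move=> a z La Iz; rewrite mulrCA; apply: IM.
  - move=> z /= /I_b bz; apply: (@val_ge_cancel _ _ w_val 0 (w b) b) => //.
    by rewrite add0r.
  - move=> a /= a_mult; rewrite -I_mult => z Iz.
    have /a_mult : [set z | I (b * z)] (b^-1 * z) by rewrite /= mulVKf.
    by rewrite /= mulrCA mulVKf.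
have [//|lt_f] : f = (2 * e)%N \/ (f < 2 * e)%N by lia.
(* Pair [z] and [t] by the [y^2]-coordinate of [z t]: the integral [t] that pair [O] into [(pi^f)]
   form the lattice with exponents [f - e] and [f], whence [e']. *)
exfalso; pose e' := (f - e)%N; have le_e' : (e' <= e)%N by rewrite /e'; lia.
have le_e'f : (e' <= f)%N by rewrite /e'; lia.
have e'E : e'%:Z = f%:Z - e%:Z by rewrite /e'; lia.
have LI : forall z t, lattice y e f z -> lattice y e' f t -> lattice y e' f (z * t).
  by move=> z t; apply: lattice_mul => //; rewrite /e'; lia.
have I_mod : is_submodule (lattice y e f) (lattice y e' f).
  by have [I0 ID _] := lattice_submodule y e' f; split.
(* Multiplying by [pi^e' y] moves the coordinates [c0, c1] up one place, modulo [pi^f O_E]. This is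
   applied with [A] the ideal, for its multiplier ring, and with [A] the order, for the inverse
   ideal. *)
have mul_y A (c0 c1 : F) b : is_submodule o A -> (forall d, val_ge w f%:Z d -> A d) ->
    val_ge w f%:Z b -> A ((c0%:E + c1%:E * y + b) * ((pi ^+ e')%:E * y)) ->
    A (lin y 0 (pi ^+ e' * c0) (pi ^+ e' * c1)).
  move=> A_mod A_f bf A_prod.
  suff -> : lin y 0 (pi ^+ e' * c0) (pi ^+ e' * c1) =
      (c0%:E + c1%:E * y + b) * ((pi ^+ e')%:E * y) - b * ((pi ^+ e')%:E * y).
    by apply: submodule_B is_subring_o A_mod A_prod _; apply: A_f; val.
  by rewrite /lin; ring.
have [||J [_ _ _] IJ] := L_gor (lattice y e' f).
- split=> //; last by exists 1; [exact: lattice_1 | exact: oner_neq0].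
  exists [:: 1; pi ^+ e' *: y; pi ^+ f *: y ^+ 2]; have spanE := lattice_span_power y_gen le_e'f.
  have oL : o `<=` lattice y e f.
    move=> c oc; rewrite -[c]mulr1; have [_ _ LM] := lattice_submodule y e f.
    by apply: LM => //; apply: lattice_1.
  apply/seteqP; split=> z.
    rewrite spanE => /span3P[a1 [a2 [a3 [oa1 oa2 oa3 ->]]]]; apply/span3P.
    by exists a1, a2, a3; split=> //; apply: oL.
  case/span3P=> [a1 [a2 [a3 [La1 La2 La3 ->]]]]; have [_ ID IM] := I_mod.
  have scaleE c t : c *: t = c%:E * t by rewrite in_algE mulr_algl.
  rewrite !scaleE; apply: (ID); [apply: (ID) |]; apply: IM => //.
  + exact: lattice_1.
  + exact: lattice_pi_y.
  + by apply: lattice_val_ge; val.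
- apply/seteqP; split=> z; last by move=> Lz t; apply: LI.
  move=> z_mult; have := z_mult _ (lattice_1 y e' f); rewrite mulr1.
  move=> [c0 [c1 [b [c00 c1e bf zE]]]].
  have := z_mult _ (lattice_pi_y y e' f); rewrite zE.
  move/(mul_y _ _ _ _ (lattice_submodule y e' f) (@lattice_val_ge y e' f) bf).
  move/(lattice_lin _ _ _ y_gen le_e'f)=> [_ _ c1f]; exists c0, c1, b; split=> //.
  apply: (val_ge_cancel v_val (expf_neq0 e' pi0) (vpi e')).
  by apply: val_geW c1f _; rewrite e'E; lia.
(* Each [c i] in the inverse ideal lies in [pi O_E], since [pi^e' c0] is in [(pi^e)] with [e' < e].
   Then so would [1], the sum of the [a i * c i]. *)
have L1 := lattice_1 y e f; rewrite -IJ in L1; case: L1 => k [a [c [Ia Jc sum1]]].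
apply: (not_val_ge_1_1 w_val); rewrite sum1; apply: val_ge_sum => // i.
have Ic t : lattice y e' f t -> lattice y e f (c i * t).
  move=> It; rewrite -IJ; exists 1%N, (fun=> t), (fun=> c i).
  by split=> //; rewrite big_ord1 mulrC.
have := Ic _ (lattice_1 y e' f); rewrite mulr1 => -[c0 [c1 [b [c00 c1e bf cE]]]].
have := Ic _ (lattice_pi_y y e' f); rewrite cE.
move/(mul_y _ _ _ _ (lattice_submodule y e f) (@lattice_val_ge y e f) bf).
move/(lattice_lin _ _ _ y_gen le_ef)=> [_ c0e _].
have c01 : val_ge v 1 c0.
  apply: (val_ge_cancel v_val (expf_neq0 e' pi0) (vpi e')).
  by apply: val_geW c0e _; rewrite e'E; lia.
have ai0 : val_ge w 0 (a i) by apply: lattice_integral (Ia i).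
have ci1 : val_ge w 1 (c0%:E + c1%:E * y + b) by val.
val.
Qed.

(** * The two families *)

Variables (x : E) (n : nat).
Hypotheses (dimE : \dim {:E}%VS = 3%N) (x_gen : integral_generator x).

Local Notation over := (is_overorder v (adjoin_integers v (pi ^+ n *: x))).
Local Notation coef1 f c := (c * pi ^+ (f - minn n f)).

Lemma val_ge_pi1 : val_ge v 1 pi.
Proof. by right; case: pi_unif => _ ->. Qed.

Lemma order1_lattice s f c : admissible1 v n s f c ->
  [/\ order1 v pi x n s f c = lattice (plin x 1 (coef1 f c)) (s - f) f,
      integral_generator (plin x 1 (coef1 f c)), primitive 1 (coef1 f c) & (s - f <= f)%N].
Proof.
move=> [le_fs le_min c0]; have le_ef : (s - f <= f)%N by lia.
have c0' : val_ge v 0 c := c0; have y_prim : primitive 1 (coef1 f c) by apply: primitive_1l; val.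
split=> //; [exact: lattice_order1 | exact: plin_generator].
Qed.

Lemma order2_lattice s f c : admissible2 v n s f c ->
  [/\ order2 v pi x s f c = lattice (plin x (c * pi) 1) (s - f) f,
      integral_generator (plin x (c * pi) 1), primitive (c * pi) 1 & (s - f < f)%N].
Proof.
move=> [[le_fs le_min c0] lt_ef]; have pi1 := val_ge_pi1.
have c0' : val_ge v 0 c := c0; have y_prim : primitive (c * pi) 1 by apply: primitive_1r; val.
split=> //; [apply: lattice_order2 => //; exact: ltnW | exact: plin_generator].
Qed.

(** The factor [pi^(f - min(n, f))] is what makes [pi^n x] a member: it lies in [pi^f O_E] if
    [f <= n], and for [n < f] it differs from [pi^n y] by a multiple of [pi^n pi^(f - n) x^2]. *)
Lemma overorder1P s f c : admissible1 v n s f c ->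
  over (order1 v pi x n s f c) <-> (f <= 2 * (s - f))%N.
Proof.
move=> adm; have [-> y_gen y_prim le_ef] := order1_lattice adm.
have [le_fs le_min c0] := adm; have c0' : val_ge v 0 c := c0.
split=> [/(overorder_lattice _ _ y_gen le_ef)[]//|le_f2e].
apply/(overorder_lattice _ _ y_gen le_ef); split=> //; apply/lattice_plin => //; first by val.
have [le_fn|lt_nf] := leqP f n.
  by exists 0; rewrite !mul0r subr0; split; [left | val | left].
exists (pi ^+ n); rewrite mulr1 subrr; split; [val | by left | val].
Qed.

(** Since [x^2] has coefficient 1 in [y], the multiple of [y] used to reach [pi^n x] must have its
    coefficient in [(pi^f)], and then [pi^n] lies there too. *)
Lemma overorder2P s f c : admissible2 v n s f c ->
  over (order2 v pi x s f c) <-> (f <= 2 * (s - f))%N /\ (f <= n)%N.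
Proof.
move=> adm; have [-> y_gen y_prim lt_ef] := order2_lattice adm; have le_ef := ltnW lt_ef.
have [[le_fs le_min c0] _] := adm; have c0' : val_ge v 0 c := c0.
have [pi0 _] := pi_unif; have pi1 := val_ge_pi1.
split=> [/(overorder_lattice _ _ y_gen le_ef)[le_f2e L_x]|[le_f2e le_fn]].
  have pin : val_ge v 0 (pi ^+ n) by val.
  have [t [_ tn]] := proj1 (lattice_plin dimE x_gen y_prim le_ef pin) L_x.
  rewrite mulr1 => tf; split=> //; have : val_ge v f%:Z (pi ^+ n).
    by rewrite -[pi ^+ n](subrK (t * (c * pi))); val.
  by move/(val_ge_valuation (expf_neq0 _ pi0)); rewrite uniformizer_exp.
apply/(overorder_lattice _ _ y_gen le_ef); split=> //; apply/lattice_plin => //; first by val.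
by exists 0; rewrite !mul0r subr0; split; [left | val | left].
Qed.

Lemma lattice_eq_exponents y y' e f e' f' : integral_generator y -> integral_generator y' ->
  (e <= f)%N -> (e' <= f')%N -> lattice y e f = lattice y' e' f' -> e = e' /\ f = f'.
Proof.
move=> y_gen y'_gen le_ef le_ef' eq_lat.
have [|le_e le_f _] := lattice_sub y_gen y'_gen le_ef le_ef' _; first by rewrite eq_lat.
have [|le_e' le_f' _] := lattice_sub y'_gen y_gen le_ef' le_ef _; first by rewrite eq_lat.
by split; lia.
Qed.

(** The determinant is [(c - c') pi^(f - min(n, f))] and must lie in [(pi^(f - e))] with
    [e = s - f]; cancelling leaves the exponent [min(n, f) - (s - f)]. *)
Lemma order1_eqP s f c s' f' c' : admissible1 v n s f c -> admissible1 v n s' f' c' ->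
  order1 v pi x n s f c = order1 v pi x n s' f' c' <->
  (s, f) = (s', f') /\ principal_ideal v (pi ^+ (minn n f - (s - f))) (c - c').
Proof.
move=> adm adm'; have [-> y_gen y_prim le_ef] := order1_lattice adm.
have [-> y'_gen y'_prim le_ef'] := order1_lattice adm'.
have [le_fs le_min _] := adm; have [le_fs' _ _] := adm'; have x0 := ig_integral x_gen.
split=> [eq_lat|[[<- <-]]].
  have [eq_e eq_f] := lattice_eq_exponents y_gen y'_gen le_ef le_ef' eq_lat.
  have eq_s : s = s' by lia.
  split; first by rewrite eq_s eq_f.
  clear adm' eq_e le_fs' le_ef'; subst s' f'.
  have := lattice_plin_eq x_gen y'_prim y_prim le_ef (esym eq_lat).
  rewrite !mul1r -mulrBl mulrC => cc; apply/(principal_idealE v_val _ _ pi_unif).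
  apply: (@val_ge_cancel _ _ v_val _ (f - minn n f)%N%:Z (pi ^+ (f - minn n f))).
  - by rewrite expf_neq0 //; case: pi_unif.
  - by rewrite uniformizer_exp.
  - by apply: val_geW cc _; lia.
move=> /(principal_idealE v_val _ _ pi_unif) cc; apply: lattice_congr.
suff -> : plin x 1 (coef1 f c) - plin x 1 (coef1 f c') =
  (c - c')%:E * (pi ^+ (f - minn n f))%:E * x ^+ 2 by val.
by rewrite /plin; ring.
Qed.

(** Here the determinant is [(c - c') pi], and the exponent [f - e = 2 f - s] loses 1 to the factor
    [pi]. *)
Lemma order2_eqP s f c s' f' c' : admissible2 v n s f c -> admissible2 v n s' f' c' ->
  order2 v pi x s f c = order2 v pi x s' f' c' <->
  (s, f) = (s', f') /\ principal_ideal v (pi ^+ (2 * f - s - 1)) (c - c').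
Proof.
move=> adm adm'; have [-> y_gen y_prim lt_ef] := order2_lattice adm.
have [-> y'_gen y'_prim lt_ef'] := order2_lattice adm'; have pi1 := val_ge_pi1.
have [[le_fs le_min _] _] := adm; have [[le_fs' _ _] _] := adm'; have x0 := ig_integral x_gen.
split=> [eq_lat|[[<- <-]]].
  have [eq_e eq_f] := lattice_eq_exponents y_gen y'_gen (ltnW lt_ef) (ltnW lt_ef') eq_lat.
  have eq_s : s = s' by lia.
  split; first by rewrite eq_s eq_f.
  clear adm' eq_e le_fs' lt_ef'; subst s' f'.
  have := lattice_plin_eq x_gen y_prim y'_prim (ltnW lt_ef) eq_lat.
  rewrite !mulr1 -mulrBl mulrC => cc; apply/(principal_idealE v_val _ _ pi_unif).
  have [pi0 vpi] := pi_unif.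
  apply: (@val_ge_cancel _ _ v_val _ 1 pi) => //; first by rewrite vpi.
  by apply: val_geW cc _; lia.
move=> /(principal_idealE v_val _ _ pi_unif) cc; apply: lattice_congr.
suff -> : plin x (c * pi) 1 - plin x (c' * pi) 1 = (c - c')%:E * pi%:E * x by val.
by rewrite /plin; ring.
Qed.

(** The determinant is congruent to 1 modulo [pi], whereas equality would put it in [(pi^(f - e))]
    with [f - e >= 1]. *)
Lemma order1_neq_order2 s f c s' f' c' : admissible1 v n s f c -> admissible2 v n s' f' c' ->
  order1 v pi x n s f c <> order2 v pi x s' f' c'.
Proof.
move=> adm adm'; have [-> y_gen y_prim le_ef] := order1_lattice adm.
have [-> y'_gen y'_prim lt_ef'] := order2_lattice adm'; have pi1 := val_ge_pi1.
have [[_ _ c'0] _] := adm'; have c'0' : val_ge v 0 c' := c'0.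
have [_ be0 _] := y_prim => eq_lat.
have [eq_e eq_f] := lattice_eq_exponents y_gen y'_gen le_ef (ltnW lt_ef') eq_lat.
rewrite -{}eq_e -{}eq_f in lt_ef' eq_lat.
have det := lattice_plin_eq x_gen y_prim y'_prim le_ef eq_lat.
apply: (not_val_ge_1_1 v_val); rewrite mulr1 in det.
by rewrite -(subrK (c' * pi * coef1 f c) 1); val.
Qed.

Lemma overorder_classification O : over O ->
  (exists s f c, admissible1 v n s f c /\ O = order1 v pi x n s f c) \/
  (exists s f c, admissible2 v n s f c /\ O = order2 v pi x s f c).
Proof.
move=> O_over; have [a [b [e [f [ab_prim le_ef OE]]]]] := overorder_plin dimE x_gen O_over.
rewrite OE in O_over *; have x0 := ig_integral x_gen; have [pi0 _] := pi_unif.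
have nf_over d0 d1 : primitive d0 d1 -> over (lattice (plin x d0 d1) e f) ->
    exists t, [/\ val_ge v e%:Z t, val_ge v f%:Z (pi ^+ n - t * d0) & val_ge v f%:Z (t * d1)].
  move=> d_prim; have y_gen := plin_generator dimE x_gen d_prim.
  have pin : val_ge v 0 (pi ^+ n) by val.
  by move=> /(overorder_lattice _ _ y_gen le_ef)[_] /(lattice_plin dimE x_gen d_prim le_ef pin).
(* [s] will be [e + f], so that [s - f] returns [e]. *)
have sub_e : (e + f - f)%N = e by lia.
have [[d d0 LE]|[d d1 LE]] := lattice_normal_form x e f ab_prim; rewrite LE in O_over *.
- left; have [t [te]] := nf_over _ _ (primitive_1l d0) O_over.
  rewrite mulr1 => tn td.
  have le_en : (e <= n)%N.
    have : val_ge v e%:Z (pi ^+ n) by rewrite -[pi ^+ n](subrK t); val.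
    by move/(val_ge_valuation (expf_neq0 _ pi0)); rewrite uniformizer_exp.
  suff [c c0 dE] : exists2 c, val_ge v 0 c & d = c * pi ^+ (f - minn n f).
    exists (e + f)%N, f, c; have adm : admissible1 v n (e + f) f c by split=> //; lia.
    by split=> //; have [-> _ _ _] := order1_lattice adm; rewrite sub_e -dE.
  (* If [n < f], both [(pi^n - t) d] and [t d] lie in [(pi^f)], so [pi^(f - n)] divides [d]. *)
  suff /val_ge_factor[c c0 ->] : val_ge v (f - minn n f)%N%:Z d by exists c; rewrite // mulrC.
  have [le_fn|lt_nf] := leqP f n; first by apply: val_geW d0 _; lia.
  apply: (@val_ge_cancel _ _ v_val _ n%:Z (pi ^+ n)); first by rewrite expf_neq0.
    by rewrite uniformizer_exp.
  suff -> : pi ^+ n * d = (pi ^+ n - t) * d + t * d by val.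
  by ring.
have d0 : val_ge v 0 d by val.
have [t [te tn]] := nf_over _ _ (primitive_1r d0) O_over; rewrite mulr1 => tf.
have le_fn : (f <= n)%N.
  have : val_ge v f%:Z (pi ^+ n) by rewrite -[pi ^+ n](subrK (t * d)); val.
  by move/(val_ge_valuation (expf_neq0 _ pi0)); rewrite uniformizer_exp.
(* With [e = f] the lattice is [o + pi^f O_E] for every [y]; it belongs to the first family, with
   [c = 0], as the second requires [s - f < f]. *)
have [eq_ef|lt_ef] : e = f \/ (e < f)%N by lia.
  left; exists (e + f)%N, f, 0.
  have adm : admissible1 v n (e + f) f 0 by split; [lia | lia | left].
  split=> //; have [-> y_gen _ _] := order1_lattice adm; rewrite sub_e; apply: lattice_congr.
  have y0 := ig_integral y_gen; have y'0 : val_ge w 0 (plin x d 1) by apply: val_ge_plin => //; val.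
  by val.
right; have /val_ge_factor[c c0 dE] : val_ge v 1%N%:Z d by [].
exists (e + f)%N, f, c; have adm : admissible2 v n (e + f) f c by split; [split=> //; lia | lia].
by split=> //; have [-> _ _ _] := order2_lattice adm; rewrite sub_e dE expr1 mulrC.
Qed.

End UnramifiedExtension.

Theorem corollary4p3 (F : fieldType) (E : fieldExtType F)
    (v : F -> int) (w : E -> int) (pi : F) (x : E) (n : nat)
    (F_local : local_field v) (E_local : local_field w)
    (E_cubic : \dim {:E}%VS = 3%N) (E_unramified : unramified v w)
    (pi_uniformizer : uniformizer v pi)
    (x_unit : integer_unit w x)
    (x_generates : ring_of_integers w = adjoin_integers v x) :
  let R := adjoin_integers v (pi ^+ n *: x) in
  let O1 := order1 v pi x n in
  let O2 := order2 v pi x in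
  let adm1 := admissible1 v n in
  let adm2 := admissible2 v n in
  let over := is_overorder v R in
  (forall s f c, adm1 s f c ->
     (over (O1 s f c) <->
      [/\ (s <= 2 * f)%N, (3 * f <= 2 * s)%N & (s <= f + n)%N])) /\
  (forall s f c, adm2 s f c ->
     (over (O2 s f c) <->
      [/\ (s < 2 * f)%N, (3 * f <= 2 * s)%N & (f <= n)%N])) /\
  (* (1) *)
  (forall s f c, adm1 s f c -> over (O1 s f c) ->
     has_colength v w (O1 s f c) s /\
     has_conductor_exponent w pi (O1 s f c) f) /\
  (forall s f c, adm2 s f c -> over (O2 s f c) ->
     has_colength v w (O2 s f c) s /\
     has_conductor_exponent w pi (O2 s f c) f) /\
  (* (2) *)
  (forall s f c s' f' c',
     adm1 s f c -> over (O1 s f c) -> adm1 s' f' c' -> over (O1 s' f' c') ->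
     (O1 s f c = O1 s' f' c' <->
      (s, f) = (s', f') /\
      principal_ideal v (pi ^+ (minn n f - (s - f))) (c - c'))) /\
  (forall s f c s' f' c',
     adm2 s f c -> over (O2 s f c) -> adm2 s' f' c' -> over (O2 s' f' c') ->
     (O2 s f c = O2 s' f' c' <->
      (s, f) = (s', f') /\
      principal_ideal v (pi ^+ (2 * f - s - 1)) (c - c'))) /\
  (* (3) *)
  (forall s f c s' f' c',
     adm1 s f c -> over (O1 s f c) -> adm2 s' f' c' -> over (O2 s' f' c') ->
     (s' < 2 * f')%N -> O1 s f c <> O2 s' f' c') /\
  (* (4) *)
  (forall s f c, adm1 s f c -> over (O1 s f c) ->
     (gorenstein (O1 s f c) <-> (3 * f = 2 * s)%N)) /\
  (forall s f c, adm2 s f c -> over (O2 s f c) ->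
     (gorenstein (O2 s f c) <-> (3 * f = 2 * s)%N)) /\
  (* every overorder of R is in the list *)
  (forall O : set E, over O ->
     (exists s f c, adm1 s f c /\ O = O1 s f c) \/
     (exists s f c, adm2 s f c /\ O = O2 s f c)).
Proof.
have v_val := local_field_valuation F_local; have w_val := local_field_valuation E_local.
have w_alg : forall a : F, a != 0 -> w a%:A = v a.
  by have [_ w_alg] := E_unramified => a a0; rewrite w_alg // mulr1n.
have x0 : val_ge w 0 x by case: x_unit.
have x_gen : integral_generator v w x.
  apply: (integral_generatorP v_val w_val w_alg) => // c0 c1 c2.
  apply: (generator_residually_independent v_val w_val w_alg pi_uniformizer) => //.
  exact: local_field_complete F_local.
move=> R O1 O2 adm1 adm2 over.
have le1 s f c : adm1 s f c -> over (O1 s f c) -> (f <= 2 * (s - f))%N.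
  move=> adm /(overorder1P v_val w_val w_alg pi_uniformizer E_cubic x_gen adm) //.
have le2 s f c : adm2 s f c -> over (O2 s f c) -> (f <= 2 * (s - f))%N.
  by move=> adm /(overorder2P v_val w_val w_alg pi_uniformizer E_cubic x_gen adm)[].
have lat1 s f c : adm1 s f c ->
    exists y, [/\ O1 s f c = lattice v w y (s - f) f, integral_generator v w y & (s - f <= f)%N].
  move=> adm; have [eqL y_gen _ le_ef] :=
    order1_lattice v_val w_val w_alg pi_uniformizer E_cubic x_gen adm.
  by eexists; split; [exact: eqL | |].
have lat2 s f c : adm2 s f c ->
    exists y, [/\ O2 s f c = lattice v w y (s - f) f, integral_generator v w y & (s - f <= f)%N].
  move=> adm; have [eqL y_gen _ lt_ef] :=
    order2_lattice v_val w_val w_alg pi_uniformizer E_cubic x_gen adm.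
  by eexists; split; [exact: eqL | | exact: ltnW].
have gorP := lattice_gorensteinP v_val w_val w_alg pi_uniformizer E_cubic.
have colength := lattice_colength v_val w_val w_alg pi_uniformizer E_cubic x_gen.
have conductor := lattice_conductor v_val w_val w_alg pi_uniformizer.
split; [|split; [|split; [|split; [|split; [|split; [|split; [|split; [|split] ] ] ] ] ] ] ].
(* [s <= 2 f] and [s <= f + n] together restate [s - f <= minn n f]. *)
- move=> s f c adm; have [le_fs le_min _] := adm.
  apply: (iff_trans (overorder1P v_val w_val w_alg pi_uniformizer E_cubic x_gen adm)).
  by split=> [le|[]]; [split|]; lia.
- move=> s f c adm; have [[le_fs le_min _] lt_ef] := adm.
  apply: (iff_trans (overorder2P v_val w_val w_alg pi_uniformizer E_cubic x_gen adm)).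
  by split=> [[]|[]]; [split|]; lia.
- move=> s f c adm _; have [y [-> y_gen le_ef]] := lat1 _ _ _ adm.
  have [le_fs _ _] := adm; rewrite -[X in has_colength _ _ _ X](subnK le_fs).
  by split; [apply: colength | apply: conductor].
- move=> s f c adm _; have [y [-> y_gen le_ef]] := lat2 _ _ _ adm.
  have [[le_fs _ _] _] := adm; rewrite -[X in has_colength _ _ _ X](subnK le_fs).
  by split; [apply: colength | apply: conductor].
- move=> s f c s' f' c' adm _ adm' _.
  exact: (order1_eqP v_val w_val w_alg pi_uniformizer E_cubic x_gen adm adm').
- move=> s f c s' f' c' adm _ adm' _.
  exact: (order2_eqP v_val w_val w_alg pi_uniformizer E_cubic x_gen adm adm').
- move=> s f c s' f' c' adm _ adm' _ _.
  exact: (order1_neq_order2 v_val w_val w_alg pi_uniformizer E_cubic x_gen adm adm').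
- move=> s f c adm /(le1 _ _ _ adm) le_f2e; have [y [-> y_gen le_ef]] := lat1 _ _ _ adm.
  have [le_fs _ _] := adm; apply: (iff_trans (gorP _ _ _ y_gen le_ef le_f2e)).
  by split; lia.
- move=> s f c adm /(le2 _ _ _ adm) le_f2e; have [y [-> y_gen le_ef]] := lat2 _ _ _ adm.
  have [[le_fs _ _] _] := adm; apply: (iff_trans (gorP _ _ _ y_gen le_ef le_f2e)).
  by split; lia.
move=> O; exact: (overorder_classification v_val w_val w_alg pi_uniformizer E_cubic x_gen).
Qed.
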